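(* There exists an absolute constant $c>0$ such that $$\delta_n \geq \frac{1}{2n} + \frac{c \log n}{n^2 (\log\log n)^2}$$ for all sufficiently large $n$.
   Context: For $t \in \mathbb{R}/\mathbb{Z}$, $\|t\|_{\mathbb{R}/\mathbb{Z}}$ denotes the distance from (any representative of) $t$ to the nearest integer. For non-zero integers $v_1,\dots,v_n$, $\delta(v_1,\dots,v_n)$ denotes the maximum over $t \in \mathbb{R}/\mathbb{Z}$ of $\min(\|tv_1\|_{\mathbb{R}/\mathbb{Z}},\dots,\|tv_n\|_{\mathbb{R}/\mathbb{Z}})$. For $n \geq 1$, $\delta_n$ denotes the infimum of $\delta(v_1,\dots,v_n)$ over all $n$-tuples $(v_1,\dots,v_n)$ of distinct non-zero integers. *)

(* Defs.v *)
From HB Require Import structures.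
From mathcomp Require Import all_boot all_order all_algebra.
From mathcomp Require Import all_classical all_reals all_analysis.
From mathcomp Require Import lra.
Set Implicit Arguments.
Unset Strict Implicit.
Unset Printing Implicit Defensive.
Import Order.TTheory GRing.Theory Num.Theory.
Import numFieldNormedType.Exports.
Local Open Scope classical_set_scope.
Local Open Scope ring_scope.

Section LonelyRunner.
Variable R : realType.
Implicit Types (t : R) (v : seq int).

Definition dist_int t : R := inf [set `|t - m%:~R| | m in [set: int]].

(* Since dist_int t <= 1/2 (dist_int_le_half), the initial value 1/2 of the
   iterated minimum is irrelevant as soon as v is nonempty. *)
Definition min_dist v t : R :=
  \big[Num.min/2^-1]_(w <- v) dist_int (t * w%:~R).

(* Elements of R/Z are given by real representatives; the supremum is attained
   (delta_max). *)
Definition delta v : R := sup [set min_dist v t | t in [set: R]].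

Definition delta_inf (n : nat) : R :=
  inf [set delta v | v in [set v : n.-tuple int | uniq v /\ 0 \notin v]].

Lemma dist_int_has_inf t : has_inf [set `|t - m%:~R| | m in [set: int]].
Proof.
split; first by exists `|t - 0%:~R|, 0.
by exists 0 => _ [m _ <-].
Qed.

Lemma dist_int_le t (m : int) : dist_int t <= `|t - m%:~R|.
Proof. by apply: ge_inf; [exact: (dist_int_has_inf t).2 | exists m]. Qed.

Lemma dist_int_ge t x : (forall m : int, x <= `|t - m%:~R|) -> x <= dist_int t.
Proof.
move=> h; apply: lb_le_inf; first exact: (dist_int_has_inf t).1.
by move=> _ [m _ <-].
Qed.

Lemma dist_int_ge0 t : 0 <= dist_int t.
Proof. by apply: dist_int_ge. Qed.

Lemma dist_int_le_half t : dist_int t <= 2^-1.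
Proof.
have := dist_int_le t (Num.floor t); have := dist_int_le t (Num.floor t + 1).
have := floor_le t; have := floorD1_gt t.
rewrite intrD; set f := (Num.floor t)%:~R.
move=> h1 h2; rewrite ler0_norm; last lra.
rewrite ger0_norm; lra.
Qed.

Lemma dist_int_lip s t : dist_int s <= dist_int t + `|s - t|.
Proof.
rewrite -lerBlDr; apply: dist_int_ge => m; rewrite lerBlDr.
apply: (le_trans (dist_int_le s m)).
by rewrite [leRHS]addrC ler_distD.
Qed.

Lemma dist_intDz t (k : int) : dist_int (t + k%:~R) = dist_int t.
Proof.
apply/eqP; rewrite eq_le; apply/andP; split; apply: dist_int_ge => m.
  by have := dist_int_le (t + k%:~R) (m + k); rewrite intrD opprD addrACA subrr addr0.
by have := dist_int_le t (m - k); rewrite intrB opprB [_%:~R - _]addrC addrA addrAC.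
Qed.

Lemma dist_int_continuous : continuous dist_int.
Proof.
move=> x; apply/cvgrPdist_lt => e e0; near=> y.
have xy : `|x - y| < e by near: y; apply: cvgr_dist_lt e0 => //; exact: cvg_id.
rewrite (le_lt_trans _ xy)// ler_norml; apply/andP; split.
  by rewrite lerNl opprB lerBlDl distrC dist_int_lip.
by rewrite lerBlDl dist_int_lip.
Unshelve. all: by end_near. Qed.

Lemma min_dist_continuous v : continuous (min_dist v).
Proof.
elim: v => [|w v IH] x.
  rewrite /continuous_at (_ : min_dist [::] = cst 2^-1); first exact: cvg_cst.
  by apply/funext => t; rewrite /min_dist big_nil.
rewrite (_ : min_dist (w :: v) =
    (fun t => Num.min (dist_int (t * w%:~R)) (min_dist v t))); last first.
  by apply/funext => t; rewrite /min_dist big_cons.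
apply: (@continuous_min R R (fun t => dist_int (t * w%:~R)) (min_dist v));
  last exact: IH.
apply: (@continuous_comp _ _ _ (fun t => t * w%:~R)).
  by apply: cvgM; [exact: cvg_id | exact: cvg_cst].
exact: dist_int_continuous.
Qed.

Lemma min_distDz v t (k : int) : min_dist v (t + k%:~R) = min_dist v t.
Proof. by apply: eq_bigr => w _; rewrite mulrDl -intrM dist_intDz. Qed.

Lemma delta_max v :
  exists2 t, delta v = min_dist v t & forall s, min_dist v s <= min_dist v t.
Proof.
have [|t _ tmax] := @EVT_max R (min_dist v) 0 1 ler01.
  by apply: continuous_subspaceT => x; exact: min_dist_continuous.
have tub s : min_dist v s <= min_dist v t.
  rewrite -(min_distDz v s (- Num.floor s)); apply: tmax.
  rewrite in_itv/= intrN subr_ge0 floor_le lerBlDr ltW//.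
  by have := floorD1_gt s; rewrite intrD addrC.
exists t => //; apply/eqP; rewrite eq_le; apply/andP; split.
  by apply: ge_sup; [exists (min_dist v 0), 0 | move=> _ [s _ <-]].
by apply: ub_le_sup; [exists (min_dist v t) => _ [s _ <-] | exists t].
Qed.

End LonelyRunner.

(* Main.v *)
(* Proof idea.  If delta(v) were smaller than the bound, the n sets
   B_w = {t : ||t w|| <= delta}, w = |v_i|, of measure 2 delta would cover the
   circle with total overlap O(L / n), L = log n / (log log n)^2; we sample t at
   the multiples of 1/Q for a large common multiple Q of the speeds.  Hence most
   w are good: B_w meets the union of the other B_w' in measure O(L / n^2).
   Near t = - b / w (b mod w), half of the component of B_w lies in B_w', w' < w,
   as soon as b w' mod w < w / 2n, so the good w satisfy
   n #{b mod w : b w' mod w < w / 2n for some w' < w} <= T w with T = O(L).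

   Let w be the largest good speed and d = w / gcd(w, w') for the other good w'.
   If d > 2n, the set of those b with b w' mod w nonzero has density >= 1 / 4n,
   and two such sets are nearly independent unless X w'' = Y w' + e w with
   coefficients of size O(T) (shortest vectors of the lattice spanned by
   (w', w'') modulo w), so there are only polylogarithmically many such w'.
   Otherwise all multiples of d count.  For a fixed d the numbers
   w' / gcd(w, w') lie in [1, 2n] and have pairwise gcd at most 2T, so nearly all
   of them are of the form s p with s <= 2T and p > sqrt(2n) prime, and there are
   O(n log log n / log n) of them by Chebyshev.  Hence K >> log n / log log n
   values of d occur, and by Mertens the union of the multiples of K integers
   <= 2n has density >> K / (n log K) >> L / n, a contradiction when the constant
   c is small. *)
Require Import Defs.
From mathcomp Require Import all_boot all_order all_algebra.
From mathcomp Require Import all_classical all_reals all_analysis.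
From mathcomp Require Import zify ring lra.
Set Implicit Arguments.
Unset Strict Implicit.
Unset Printing Implicit Defensive.
Import Order.TTheory GRing.Theory Num.Theory.
Import numFieldNormedType.Exports.

(** * Chebyshev's bound and sets with small pairwise gcd *)

(** The two middle coefficients of row [2 m + 1] are equal, and together at most the row sum
    [2 * 4 ^ m]. *)
Lemma bin_odd_central_le m : 'C(m.*2.+1, m) <= 4 ^ m.
Proof.
have h : 'C(m.*2.+1, m) + 'C(m.*2.+1, m.+1) <= 2 ^ m.*2.+1.
  have -> : 2 ^ m.*2.+1 = (1 + 1) ^ m.*2.+1 by [].
  rewrite expnDn.
  under eq_bigr => i _ do rewrite !exp1n !muln1.
  have h1 : m < m.*2.+2 by lia.
  have h2 : m.+1 < m.*2.+2 by lia.
  rewrite (bigD1 (Ordinal h1)) //= (bigD1 (Ordinal h2)) /=; last first.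
    by apply/eqP => -[]; lia.
  by rewrite addnA leq_addr.
have e : 'C(m.*2.+1, m.+1) = 'C(m.*2.+1, m).
  by rewrite -bin_sub; [congr 'C(_, _); lia | lia].
have -> : 4 ^ m = 2 ^ m.*2 by rewrite -mul2n expnM.
by move: h; rewrite e expnS; lia.
Qed.

Lemma prod_primes_dvd (s : seq nat) n :
  uniq s -> all prime s -> all (fun p => p %| n) s -> \prod_(p <- s) p %| n.
Proof.
elim: s => [|p s IH] /=; first by rewrite big_nil dvd1n.
case/andP => ps us /andP [pp ap] /andP [pn an].
rewrite big_cons Gauss_dvd ?pn ?IH //.
rewrite big_seq; elim/big_rec: _ => [|q r qs]; first exact: coprimen1.
rewrite coprimeMr => ->; rewrite andbT prime_coprime // dvdn_prime2 //.
  by apply: contra ps => /eqP ->.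
exact: (allP ap).
Qed.

Lemma prime_dvd_fact p m : prime p -> p %| m`! -> p <= m.
Proof.
move=> pp; elim: m => [|m IH]; first by rewrite fact0 Euclid_dvd1.
rewrite factS Euclid_dvdM // => /orP [/dvdn_leq -> //|/IH]; lia.
Qed.

(** Erdos's argument: an even [n > 2] contributes no new prime, and for [n = 2 m + 1] the primes
    from [m + 2] to [2 m + 1] all divide ['C(2 m + 1, m)]. *)
Lemma primorial_le n : \prod_(2 <= p < n.+1 | prime p) p <= 4 ^ n.
Proof.
elim/ltn_ind: n => -[|[|n]] IH; try by rewrite big_geq.
have [on|en] := boolP (odd n.+2); last first.
  have [->|n0] := eqVneq n 0.
    by rewrite big_mkcond big_nat1.
  rewrite big_mkcond big_nat_recr //= -big_mkcond /=.
  have -> : prime n.+2 = false.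
    apply/negP => pn; have := even_prime pn; case=> [[]|]; first lia.
    by apply/negP.
  rewrite muln1 (leq_trans (IH n.+1 _)) // leq_exp2l //.
pose m := n.+2./2.
have mE : n.+2 = m.*2.+1 by rewrite /m -[LHS]odd_double_half on.
have m0 : 0 < m by lia.
rewrite mE (@big_cat_nat _ _ _ m.+2) /=; [|lia|lia].
have -> : 4 ^ m.*2.+1 = 4 ^ m.+1 * 4 ^ m by rewrite -expnD; congr (_ ^ _); lia.
apply: leq_mul; first by apply: IH; lia.
apply: leq_trans (bin_odd_central_le m).
apply: dvdn_leq; first by rewrite bin_gt0; lia.
rewrite -big_filter; apply: prod_primes_dvd.
- by rewrite filter_uniq // iota_uniq.
- by rewrite filter_all.
apply/allP => p; rewrite mem_filter mem_index_iota => /and3P [pp p1 p2].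
have := bin_fact (_ : m <= m.*2.+1).
move=> /(_ ltac:(lia)) h.
have : p %| (m.*2.+1)`! by rewrite dvdn_fact //; lia.
rewrite -h Euclid_dvdM // => /orP [//|].
by rewrite Euclid_dvdM // => /orP [] /(prime_dvd_fact pp); lia.
Qed.

(** Chebyshev's bound in multiplicative form: each counted prime contributes a factor at least [y]
    to the primorial. *)
Lemma count_primes_le y x :
  y ^ count (fun p => prime p && (y <= p)) (iota 1 x) <= 4 ^ x.
Proof.
apply: leq_trans (primorial_le x).
rewrite big_mkcond -size_filter.
have -> : \prod_(2 <= i < x.+1) (if prime i then i else 1) =
   \prod_(i <- iota 1 x) (if prime i then i else 1).
  case: x => [|x]; first by rewrite big_geq // big_nil.
  by rewrite /index_iota subSS subn1 /= big_cons /= mul1n.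
elim: (iota 1 x) => [|p s IH] /=; first by rewrite big_nil.
rewrite big_cons; case: (boolP (prime p)) => pp /=; last by rewrite mul1n.
case: (leqP y p) => yp /=; first by rewrite expnS leq_mul.
by rewrite (leq_trans IH) // leq_pmull // prime_gt0.
Qed.

Lemma size_le_allpairs3 (T1 T2 T3 S : eqType) (f : S -> T1 * T2 * T3)
    (s : seq S) (s1 : seq T1) (s2 : seq T2) (s3 : seq T3) :
  uniq s -> {in s &, injective f} ->
  {in s, forall x, [&& (f x).1.1 \in s1, (f x).1.2 \in s2 & (f x).2 \in s3]} ->
  size s <= size s1 * size s2 * size s3.
Proof.
move=> us fi fs.
rewrite -(size_map f) -(size_allpairs (fun x y => (x, y)) s1 s2).
rewrite -(size_allpairs (fun x y => (x, y)) _ s3).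
apply: uniq_leq_size; first by rewrite map_inj_in_uniq.
move=> _ /mapP [x xs ->]; have /and3P [h1 h2 h3] := fs x xs.
by case: (f x) h1 h2 h3 => -[a b] c /= *; rewrite !allpairs_f.
Qed.

(* If two elements of [A] never share a divisor in [[T, T y)], then all but
   [T y] elements have no divisor there, and such an element is [< T] or of the
   form [s p] with [s < T] its largest divisor below [T] and [p >= y] prime. *)
Lemma size_small_gcd (A : seq nat) N T y :
  uniq A -> {in A, forall a, 0 < a <= N} -> 0 < T -> N < y * y ->
  {in A &, forall a a', a <> a' -> gcdn a a' < T} ->
  size A <= T * y + T +
    \sum_(1 <= s < T) count (fun p => prime p && (y <= p)) (iota 1 (N %/ s)).
Proof.
move=> uA AN T0 Ny gA.
pose P a := has (fun d => d %| a) (index_iota T (T * y)).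
rewrite -(count_predC P) -addnA; apply: leq_add.
  rewrite -size_filter.
  pose f a := nth 0 (index_iota T (T * y)) (find (fun d => d %| a) (index_iota T (T * y))).
  have fP a : P a -> (f a %| a) && (f a \in index_iota T (T * y)).
    by move=> Pa; rewrite /f mem_nth -?has_find // andbT; exact: (nth_find 0 Pa).
  rewrite -(size_map f).
  have -> : T * y = size (iota 0 (T * y)) by rewrite size_iota.
  apply: uniq_leq_size.
    rewrite map_inj_in_uniq ?filter_uniq // => a b.
    rewrite !mem_filter => /andP [Pa aA] /andP [Pb bA] fab.
    apply/eqP; apply/negPn/negP => /eqP nab.
    have := gA _ _ aA bA nab.
    have /andP [h1] := fP _ Pa; rewrite mem_index_iota => /andP [h2 _].
    have /andP [h3 _] := fP _ Pb.
    rewrite ltnNge (leq_trans h2) // dvdn_leq ?gcdn_gt0 ?(andP (AN _ aA)).1 //.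
    by rewrite dvdn_gcd h1 fab.
  move=> x /mapP [a]; rewrite mem_filter => /andP [Pa _] ->.
  by have /andP [_] := fP _ Pa; rewrite mem_index_iota mem_iota => /andP [].
pose S := flatten [seq [seq s * p | p <- iota 1 (N %/ s) & prime p && (y <= p)]
                  | s <- index_iota 1 T].
have sS : size S = \sum_(1 <= s < T)
    count (fun p => prime p && (y <= p)) (iota 1 (N %/ s)).
  rewrite size_flatten /shape -map_comp sumnE big_map; apply: eq_bigr => s _ /=.
  by rewrite size_map size_filter.
rewrite -size_filter -sS -{1}(size_iota 0 T) -size_cat.
apply: uniq_leq_size; first by rewrite filter_uniq.
move=> a; rewrite mem_filter mem_cat mem_iota /= => /andP [nP aA].
have /andP [a0 aN] := AN a aA.
case: (ltnP a T) => //= Ta.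
have T1 : 1 < T.
  rewrite ltnNge; apply/negP => T1; have TE : T = 1 by lia.
  have y1 : 1 < y by nia.
  by move/hasPn: nP => /(_ 1); rewrite mem_index_iota TE mul1n dvd1n y1 => /(_ isT).
have ex : exists s, (s %| a) && (s < T) by exists 1; rewrite dvd1n.
case: (ex_maxnP ex (_ : forall s, (s %| a) && (s < T) -> s <= T)).
  by move=> s /andP []; lia.
move=> s /andP [sa sT] smax.
have s0 : 0 < s by apply: contraLR sa; rewrite lt0n negbK => /eqP ->; rewrite dvd0n; lia.
pose r := a %/ s; have aE : a = s * r by rewrite mulnC divnK.
have r1 : 1 < r by rewrite ltnNge; apply/negP => r1; move: aE; nia.
(* A prime [p < y] dividing [r] would give a divisor [s * p] of [a] that either is below [T],
   against the choice of [s], or lies in [[T, T y)]. *)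
have big p : prime p -> p %| r -> y <= p.
  move=> pp pr; rewrite leqNgt; apply/negP => py.
  have spa : s * p %| a by rewrite aE dvdn_pmul2l.
  have p1 := prime_gt1 pp.
  case: (ltnP (s * p) T) => spT.
    by have := smax (s * p); rewrite spa spT => /(_ isT); nia.
  move/hasPn: nP => /(_ (s * p)); rewrite mem_index_iota spT spa /=.
  by case: ltnP => [_ /(_ isT) //|]; nia.
(* Two prime factors would both be at least [y], so that [r >= y * y > N]. *)
have pr : prime r.
  have pq := pdiv_prime r1; have qd := pdiv_dvd r.
  have [e|r'1] := leqP (r %/ pdiv r) 1.
    have rE : r = r %/ pdiv r * pdiv r by rewrite divnK.
    have -> : r = pdiv r by case: (r %/ pdiv r) e rE => [|[|]] //=; lia.
    by [].
  have pq' := pdiv_prime r'1.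
  have h2 : y <= pdiv (r %/ pdiv r).
    apply: big => //; apply: dvdn_trans (pdiv_dvd _) _; exact: dvdn_div.
  have h3 := pdiv_leq (ltnW r'1).
  have h4 := big _ pq qd.
  have rE : r = r %/ pdiv r * pdiv r by rewrite divnK.
  nia.
apply/flattenP; exists [seq s * p | p <- iota 1 (N %/ s) & prime p && (y <= p)].
  by apply/mapP; exists s => //; rewrite mem_index_iota s0.
apply/mapP; exists r => //; rewrite mem_filter pr (big r) //= mem_iota.
by rewrite ltnW //= add1n ltnS leq_divRL // mulnC -aE.
Qed.

(** * Speeds with a large denominator *)

Definition near_mult n w w' b := 2 * n * ((b * w') %% w) < w.
(** Multiples of [w / gcdn w w'] are excluded: [b = 0] would be common to all [w'], and a common [b]
    is to supply a nonzero lattice vector. *)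
Definition near_nonmult n w w' b := (0 < (b * w') %% w) && near_mult n w w' b.

(** With [g = gcdn w w'] and [d = w / g], the residues [b w' mod w] run [g] times over the multiples
    [g r], [r < d]; those with [1 <= r <= (d - 1) / 2n] qualify. *)
Lemma count_near_nonmult_ge n w w' : 0 < n -> 0 < w -> 2 * n < w %/ gcdn w w' ->
  w <= 4 * n * count (near_nonmult n w w') (iota 0 w).
Proof.
move=> n0 w0; set g := gcdn w w'; set d := w %/ g => nd.
have g0 : 0 < g by rewrite gcdn_gt0 w0.
have wE : w = g * d by rewrite mulnC divnK ?dvdn_gcdl.
pose w1 := w' %/ g; have w'E : w' = g * w1 by rewrite mulnC divnK ?dvdn_gcdr.
have d0 : 1 < d by lia.
have w10 : 0 < w1.
  rewrite lt0n; apply/eqP => z; have w'0 : w' = 0 by rewrite w'E z muln0.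
  by move: nd; rewrite /d /g w'0 gcdn0 divnn w0; lia.
have cop : gcdn w1 d = 1.
  have : g * gcdn w1 d = g by rewrite muln_gcdr -wE -w'E gcdnC.
  nia.
case: (egcdnP d w10) => km kn kE _; rewrite cop in kE.
have inv r : r < d -> ((r * km) %% d * w1) %% d = r.
  move=> rd; rewrite modnMml -mulnA kE mulnDr muln1 mulnA modnMDl modn_small //.
pose R := (d - 1) %/ (2 * n).
have R1 : d <= 4 * n * R.
  have h1 : 2 * n * 1 <= d - 1 by lia.
  have : 1 <= R by rewrite /R leq_divRL; lia.
  have : d - 1 < R.+1 * (2 * n) by rewrite /R ltn_ceil //; lia.
  nia.
have Rd r : r <= R -> 2 * n * r < d.
  have : R * (2 * n) <= d - 1 by apply: leq_trunc_div.
  nia.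
have Rlt r : r <= R -> r < d.
  by move/Rd; apply: leq_ltn_trans; rewrite leq_pmull // muln_gt0.
pose L := [seq (r * km) %% d + d * j | r <- iota 1 R, j <- iota 0 g].
have sL : size L = R * g by rewrite size_allpairs !size_iota.
suff : size L <= count (near_nonmult n w w') (iota 0 w).
  rewrite sL => h; rewrite {1}wE; apply: leq_trans (leq_mul (leqnn (4 * n)) h).
  by rewrite mulnA mulnC leq_mul2r R1 orbT.
rewrite -size_filter; apply: uniq_leq_size.
  apply: allpairs_uniq; rewrite ?iota_uniq // => -[r j] [r' j'].
  move=> /allpairsP [[? ?]] /= [rR _ [rE _]] /allpairsP [[? ?]] /= [rR' _ [rE' _]] e.
  move: rR rR'; rewrite -rE -rE' !mem_iota => rR rR'.
  
  have e1 : (r * km) %% d = (r' * km) %% d.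
    have modE a i : (a %% d + d * i) %% d = a %% d.
      by rewrite -modnDmr modnMr addn0 modn_mod.
    by move/(congr1 (modn^~ d)): e => /=; rewrite !modE.
  congr (_, _); last first.
    by move: e; rewrite e1 => /addnI /eqP; rewrite eqn_pmul2l ?(ltnW d0) // => /eqP.
  by rewrite -(inv r) ?Rlt // ?e1 ?inv ?Rlt //; lia.
move=> x /allpairsP [[r j]] /= [rR jg ->]; move: rR jg; rewrite !mem_iota => rR jg.
have hr := Rd r; have rd : r < d by apply: Rlt; lia.
have h := ltn_pmod (r * km) (ltnW d0).
have E : ((r * km) %% d + d * j) * w' %% w = g * r.
  rewrite w'E wE mulnCA -muln_modr; congr (_ * _).
  by rewrite mulnDl -mulnA -modnDmr modnMr addn0 inv.
rewrite mem_filter mem_iota /near_nonmult /near_mult E.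
have r0 : 0 < r by lia.
have hr2 : 2 * n * r < d by apply: hr; lia.
apply/andP; split; first (apply/andP; split).
- by rewrite muln_gt0 g0.
- by rewrite mulnCA wE ltn_pmul2l.
- rewrite add0n /= wE; apply: leq_trans (_ : d + d * j <= _); first by rewrite ltn_add2r.
  by rewrite -mulnS mulnC leq_mul2r; apply/orP; right; lia.
Qed.

Lemma eq_divn_ltn a b m : 0 < m -> a %/ m = b %/ m -> a < b + m.
Proof.
move=> m0 e; rewrite (divn_eq a m) (divn_eq b m) e.
have := ltn_pmod a m0; move: (a %% m) (b %% m) (b %/ m * m) => u v z; lia.
Qed.

(** The lattice spanned by [(w1, w2)], [(w, 0)] and [(0, w)]: the integer vectors congruent modulo
    [w] to a multiple of [(w1, w2)]. *)
Definition mult_lattice (w w1 w2 : nat) (X Y : int) :=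
  exists b i j : int, (X = b * w1%:Z + i * w%:Z /\ Y = b * w2%:Z + j * w%:Z)%R.

Lemma mult_latticeB w w1 w2 X Y X' Y' :
  mult_lattice w w1 w2 X Y -> mult_lattice w w1 w2 X' Y' ->
  mult_lattice w w1 w2 (X - X')%R (Y - Y')%R.
Proof.
move=> [b [i [j [-> ->]]]] [b' [i' [j' [-> ->]]]].
exists (b - b')%R, (i - i')%R, (j - j')%R; split; ring.
Qed.

Lemma mult_lattice_mod w w1 w2 b :
  mult_lattice w w1 w2 ((b * w1) %% w)%:Z%R ((b * w2) %% w)%:Z%R.
Proof.
exists (b%:Z)%R, (- ((b * w1) %/ w)%:Z)%R, (- ((b * w2) %/ w)%:Z)%R.
split; [have := divn_eq (b * w1) w | have := divn_eq (b * w2) w]; lia.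
Qed.

(** Divisibility by the covolume of the lattice: in the determinant the terms in [w1 w2] cancel, and
    every other term contains [w] times one of [w], [w1], [w2]. *)
Lemma mult_lattice_cross w w1 w2 X Y X' Y' :
  mult_lattice w w1 w2 X Y -> mult_lattice w w1 w2 X' Y' ->
  exists e, (X * Y' - Y * X' = e * (w * gcdn w (gcdn w1 w2))%:Z)%R.
Proof.
move=> [b [i [j [-> ->]]]] [b' [i' [j' [-> ->]]]].
set k := gcdn _ _.
have /dvdnP [a aE] : k %| w by exact: dvdn_gcdl.
have /dvdnP [a1 a1E] : k %| w1.
  by apply: dvdn_trans (dvdn_gcdr _ _) _; exact: dvdn_gcdl.
have /dvdnP [a2 a2E] : k %| w2.
  by apply: dvdn_trans (dvdn_gcdr _ _) _; exact: dvdn_gcdr.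
exists (b * j' * a1%:Z + i * b' * a2%:Z + i * j' * a%:Z
       - (b * i' * a2%:Z + j * b' * a1%:Z + j * i' * a%:Z))%R.
have E1 : (w1%:Z = a1%:Z * k%:Z)%R by rewrite -PoszM -a1E.
have E2 : (w2%:Z = a2%:Z * k%:Z)%R by rewrite -PoszM -a2E.
have E : (w%:Z = a%:Z * k%:Z)%R by rewrite -PoszM -aE.
rewrite PoszM E1 E2 E; ring.
Qed.

(* [u = (ux, uy)] is a shortest lattice vector in the sup norm, of length [m].
   A point [p = (x, y)] of the lattice in the box is determined by its line
   parallel to [u], that is by the multiple [u x p] of [w k], together with
   [x %/ m]; and [k] values of [b] give the same point. *)
Lemma count_common_near_aux n w w1 w2 (ux uy : int) m k :
  k = gcdn w (gcdn w1 w2) -> 0 < n -> 0 < w -> 0 < m ->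
  mult_lattice w w1 w2 ux uy -> `|ux| = m -> `|uy| <= m ->
  (forall X Y, mult_lattice w w1 w2 X Y -> `|X| < m -> `|Y| < m ->
     X = 0%R /\ Y = 0%R) ->
  count (predI (near_nonmult n w w1) (near_nonmult n w w2)) (iota 0 w) <=
    (w %/ (2 * n * m)).+1 * (2 * (m %/ (n * k))).+1 * k.
Proof.
move=> kE n0 w0 m0 uL uxm uym umin.
have k0 : 0 < k by rewrite kE gcdn_gt0 w0.
have kw : k * (w %/ k) = w by rewrite mulnC divnK // kE dvdn_gcdl.
set F := m %/ (n * k).
pose x b := (b * w1) %% w; pose y b := (b * w2) %% w.
pose cr b : int := (ux * (y b)%:Z - uy * (x b)%:Z)%R.
pose f b := (x b %/ m, divz (cr b) (w * k)%:Z%R, b %/ (w %/ k)).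
have crE b : (divz (cr b) (w * k)%:Z * (w * k)%:Z = cr b)%R.
  have [e eE] := mult_lattice_cross uL (mult_lattice_mod w w1 w2 b).
  by rewrite /cr /x /y eE -kE mulzK // eqz_nat -lt0n muln_gt0 w0.
rewrite -size_filter.
have := @size_le_allpairs3 _ _ _ _ f
  [seq b <- iota 0 w | predI (near_nonmult n w w1) (near_nonmult n w w2) b]
  (iota 0 (w %/ (2 * n * m)).+1)
  [seq (i%:Z - F%:Z)%R | i <- iota 0 (2 * F).+1] (iota 0 k).
rewrite size_map !size_iota; apply.
- by rewrite filter_uniq ?iota_uniq.
- move=> b b' _ _ [ex ec eb].
  have ecr : cr b = cr b' by rewrite -crE ec crE.
  have dx : (`|(x b)%:Z - (x b')%:Z| < m)%R.
    have := eq_divn_ltn m0 ex; have := eq_divn_ltn m0 (esym ex).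
    by move: (x b) (x b') => z z'; clear; lia.
  (* Equal cross products make the difference of the two points parallel to [u]; as
     [|uy| <= |ux| = m], its second coordinate is below [m] like the first, so it vanishes. *)
  have eq1 : (ux * ((y b)%:Z - (y b')%:Z) = uy * ((x b)%:Z - (x b')%:Z))%R.
    by move: ecr; rewrite /cr; move: (x b) (x b') (y b) (y b'); clear; lia.
  have dx' : `|((x b)%:Z - (x b')%:Z)%R| < m.
    by move: dx; move: (x b) (x b') => z z'; clear; lia.
  have dy : `|((y b)%:Z - (y b')%:Z)%R| < m.
    have := congr1 absz eq1; rewrite !abszM uxm => eq2.
    rewrite -(ltn_pmul2l m0) eq2 (leq_ltn_trans (leq_mul uym (leqnn _))) //.
    by rewrite ltn_pmul2l.
  have [xx yy] := umin _ _ (mult_latticeB (mult_lattice_mod w w1 w2 b)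
     (mult_lattice_mod w w1 w2 b')) dx' dy.
  wlog bb : b b' eb {ex ec ecr dx dx' eq1 dy} xx yy / b <= b'.
    move=> hw; case: (leqP b b') => bb; first exact: hw.
    by symmetry; apply: hw; rewrite -?eb ?(ltnW bb) // -opprB ?xx ?yy oppr0.
  have X1 : w %| (b' - b) * w1.
    rewrite mulnBl -eqn_mod_dvd ?leq_mul //; apply/eqP.
    by move: xx; move: (_ %% _) (_ %% _); clear; lia.
  have X2 : w %| (b' - b) * w2.
    rewrite mulnBl -eqn_mod_dvd ?leq_mul //; apply/eqP.
    by move: yy; move: (_ %% _) (_ %% _); clear; lia.
  (* [b] and [b'] agree modulo [w / k], and by the third component of [f] they lie in the same block
     of length [w / k]. *)
  have : w %| k * (b' - b).
    by rewrite mulnC kE !muln_gcdr !dvdn_gcd X1 X2 dvdn_mull.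
  rewrite -[X in X %| _]kw dvdn_pmul2l // => bd.
  have wk0 : 0 < w %/ k by rewrite divn_gt0 // dvdn_leq // kE dvdn_gcdl.
  have := eq_divn_ltn wk0 (esym eb).
  have [b0 _|b0] := posnP (b' - b).
    by apply/eqP; rewrite eqn_leq bb -subn_eq0 b0.
  have := dvdn_leq b0 bd; move: (w %/ k) bb => z; clear; lia.
move=> b; rewrite mem_filter mem_iota => /andP [h bw].
have {h} /andP [/andP [x0 xw] /andP [y0 yw]] :
  near_nonmult n w w1 b && near_nonmult n w w2 b := h.
have {}bw : b < w := bw.
apply/and3P; split.
- change (x b %/ m \in iota 0 (w %/ (2 * n * m)).+1).
  rewrite mem_iota add0n leq0n andTb ltnS leq_divRL ?muln_gt0 ?n0 //.
  have : x b %/ m * m <= x b by exact: leq_trunc_div.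
  move: xw; rewrite /near_mult -/(x b); move: (x b) (x b %/ m); clear; nia.
- change (divz (cr b) (w * k)%:Z%R \in [seq (i%:Z - F%:Z)%R | i <- iota 0 (2 * F).+1]).
  set e := divz _ _.
  (* Both coordinates are below [w / 2n], so the cross product is below [m w / n], which leaves
     [|e| <= m / (n k)]. *)
  have he : n * k * `|e| <= m.
    have h := congr1 absz (crE b); rewrite abszM -/e /= in h.
    have h2 : `|cr b| <= m * y b + m * x b.
      rewrite /cr.
      have h3 : `|(ux * (y b)%:Z)%R| = m * y b by rewrite abszM uxm.
      have h4 : `|(uy * (x b)%:Z)%R| <= m * x b by rewrite abszM leq_mul.
      by move: h3 h4; move: (x b) (y b); clear; lia.
    move: xw yw; rewrite /near_mult -/(x b) -/(y b) => xw yw.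
    have : 2 * n * (`|e| * (w * k)) < 2 * m * w.
      rewrite h; apply: leq_ltn_trans (_ : 2 * n * (m * y b + m * x b) < _).
        by rewrite leq_mul.
      by move: xw yw m0; move: (x b) (y b); clear; nia.
    rewrite (_ : 2 * n * _ = (2 * w) * (n * k * `|e|)); last by ring.
    by rewrite (_ : 2 * m * w = 2 * w * m); [rewrite ltn_pmul2l ?muln_gt0 // => /ltnW | ring].
  have eF : `|e| <= F by rewrite leq_divRL ?muln_gt0 ?n0 // mulnC.
  apply/mapP; exists (absz (e + F%:Z)%R); [rewrite mem_iota|]; move: (e) (F) eF => z c; clear; lia.
- by rewrite mem_iota add0n leq0n andTb ltn_divLR ?kw // divn_gt0 // dvdn_leq // kE dvdn_gcdl.
Qed.

Definition int_range (H : nat) : seq int := [seq (i%:Z - H%:Z)%R | i <- iota 0 (2 * H).+1].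

Lemma mem_int_range H (x : int) : (x \in int_range H) = (`|x| <= H).
Proof.
apply/mapP/idP => [[i]|xH]; first by rewrite mem_iota; lia.
exists (absz (x + H%:Z)%R); [rewrite mem_iota; lia | lia].
Qed.

Lemma size_int_range H : size (int_range H) = (2 * H).+1.
Proof. by rewrite size_map size_iota. Qed.

(* The [w2] with [X w2 = Y w1 + e w] for some [X, Y, e] of size [O(H)]; the
   entries with [X = 0] are junk. *)
Definition related H w w1 : seq nat :=
  [seq `|divz (YX.1 * w1%:Z + e * w%:Z)%R YX.2|%N |
     YX <- [seq (Y, X) | Y <- int_range H, X <- int_range H], e <- int_range (2 * H)].

Lemma size_related H w w1 :
  size (related H w w1) = (2 * H).+1 * (2 * H).+1 * (4 * H).+1.
Proof. by rewrite !size_allpairs !size_int_range; congr (_ * _.+1); lia. Qed.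

Lemma mem_related H w w1 w2 (X Y e : int) : X != 0%R ->
  `|X| <= H -> `|Y| <= H -> `|e| <= 2 * H ->
  (X * w2%:Z = Y * w1%:Z + e * w%:Z)%R -> w2 \in related H w w1.
Proof.
move=> X0 XH YH eH E; apply/allpairsP; exists ((Y, X), e).
rewrite allpairs_f ?mem_int_range //=; split => //.
by rewrite -E mulrC mulzK // absz_nat.
Qed.

Lemma mult_latticeC w w1 w2 X Y : mult_lattice w w1 w2 X Y -> mult_lattice w w2 w1 Y X.
Proof. by move=> [b [i [j [-> ->]]]]; exists b, j, i. Qed.

(** If the shortest lattice vector has length [m > H k], the bound of [count_common_near_aux] is
    small enough. Otherwise it is [k (X, Y)] with [X, Y] of size at most [H], and its cross product
    with [(w1, w2)] gives [X w2 = Y w1 + e w], so that [w2] is [related]. *)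
Lemma count_common_near n w w1 w2 H :
  0 < n -> 0 < w -> w1 < w -> w2 < w -> 2 * H <= n ->
  2 * n < w %/ gcdn w w1 -> w2 \notin related H w w1 ->
  n * H * count (predI (near_nonmult n w w1) (near_nonmult n w w2)) (iota 0 w) <= 2 * w.
Proof.
move=> n0 w0 w1w w2w Hn d1 nrel.
set P := predI _ _.
have [/hasP [b _ /andP [b1 b2]]|/hasPn nb] := boolP (has P (iota 0 w)); last first.
  have -> : count P (iota 0 w) = 0.
    by rewrite -(@eq_in_count _ pred0) ?count_pred0 // => x /nb /negbTE.
  by rewrite muln0.
pose Q m := `[< exists X Y, mult_lattice w w1 w2 X Y /\ maxn `|X| `|Y| = m /\ 0 < m >].
have exQ : exists m, Q m.
  exists (maxn `|((b * w1) %% w)%:Z%R| `|((b * w2) %% w)%:Z%R|); apply/asboolP.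
  exists ((b * w1) %% w)%:Z%R, ((b * w2) %% w)%:Z%R.
  split; [exact: mult_lattice_mod | split => //].
  by rewrite leq_max; case/andP: b1 => ->.
case: (ex_minnP exQ) => m /asboolP [ux [uy [uL [uM m0]]]] mmin.
have mle : 2 * n * m <= w.
  have : m <= maxn ((b * w1) %% w) ((b * w2) %% w).
    apply: mmin; apply/asboolP.
    exists ((b * w1) %% w)%:Z%R, ((b * w2) %% w)%:Z%R.
    split; [exact: mult_lattice_mod | split => //].
    by rewrite leq_max; case/andP: b1 => ->.
  case/andP: b1 => _ h1; case/andP: b2 => _ h2.
  rewrite leq_max => /orP [] h; apply: leq_trans (leq_mul (leqnn _) h) (ltnW _) => //.
have umin X Y : mult_lattice w w1 w2 X Y -> `|X| < m -> `|Y| < m -> X = 0%R /\ Y = 0%R.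
  move=> XY Xm Ym.
  have : ~~ Q (maxn `|X| `|Y|).
    by apply/negP => /mmin; rewrite leq_max => /orP []; rewrite leqNgt ?Xm ?Ym.
  move/asboolPn => h.
  have : maxn `|X| `|Y| = 0.
    by case: (posnP (maxn `|X| `|Y|)) => // h0; case: h; exists X, Y.
  by move/eqP; rewrite -leqn0 geq_max; clear; lia.
pose k := gcdn w (gcdn w1 w2).
have k0 : 0 < k by rewrite gcdn_gt0 w0.
have kw : k %| w by exact: dvdn_gcdl.
have kw1 : k %| w1 by apply: dvdn_trans (dvdn_gcdr _ _) _; exact: dvdn_gcdl.
have kw2 : k %| w2 by apply: dvdn_trans (dvdn_gcdr _ _) _; exact: dvdn_gcdr.
have Hkm : H * k < m.
  rewrite ltnNge; apply/negP => mHk.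
  have [X XE] : exists X, (ux = X * k%:Z)%R.
    have [b' [i [_ [-> _]]]] := uL.
    by apply/dvdzP; rewrite rpredD ?dvdz_mull.
  have [Y YE] : exists Y, (uy = Y * k%:Z)%R.
    have [b' [_ [j [_ ->]]]] := uL.
    by apply/dvdzP; rewrite rpredD ?dvdz_mull.
  have [e eE] : exists e, (ux * w2%:Z - uy * w1%:Z = e * (w * k)%:Z)%R.
    by apply: (mult_lattice_cross uL); exists 1%R, 0%R, 0%R; rewrite !mul0r !mul1r !addr0.
  have E : (X * w2%:Z - Y * w1%:Z = e * w%:Z)%R.
    have kz : (k%:Z != 0)%R by move: k0; clear; lia.
    apply: (mulIf kz); rewrite -[in RHS]mulrA -PoszM -eE XE YE; ring.
  have Xk : `|X| * k <= m by rewrite -uM XE YE !abszM !absz_nat leq_max leqnn.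
  have Yk : `|Y| * k <= m by rewrite -uM XE YE !abszM !absz_nat leq_max leqnn orbT.
  have XH : `|X| <= H by rewrite -(leq_pmul2r k0) (leq_trans Xk).
  have YH : `|Y| <= H by rewrite -(leq_pmul2r k0) (leq_trans Yk).
  have eH : `|e| <= 2 * H.
    rewrite -(leq_pmul2r w0) -[w in leqLHS]absz_nat -abszM -E.
    have : `|(X * w2%:Z)%R| <= H * w by rewrite abszM leq_mul // ltnW.
    have : `|(Y * w1%:Z)%R| <= H * w by rewrite abszM leq_mul // ltnW.
    by move: (X * _)%R (Y * _)%R; clear; lia.
  (* [X = 0] would give [w | Y w1], hence [w / gcdn w w1 <= |Y| <= H], against the large denominator
     of [w1]. *)
  have X0 : X != 0%R.
    apply/negP => /eqP X0.
    have Y0 : 0 < `|Y|.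
      rewrite lt0n; apply/eqP => Y0; move: uM m0; rewrite XE YE X0 !abszM Y0.
      by rewrite !mul0n maxnn => <-.
    have : w %| `|Y| * w1.
      have := congr1 absz E; rewrite X0 mul0r add0r abszN !abszM !absz_nat => ->.
      by rewrite dvdn_mull.
    have g0 : 0 < gcdn w w1 by rewrite gcdn_gt0 w0.
    have wE := esym (divnK (dvdn_gcdl w w1)); have w1E := esym (divnK (dvdn_gcdr w w1)).
    rewrite [X in X %| _]wE [X in _ %| _ * X]w1E mulnA.
    rewrite dvdn_pmul2r // Gauss_dvdl; last first.
      rewrite /coprime -(eqn_pmul2r g0) muln_gcdl !divnK ?dvdn_gcdl ?dvdn_gcdr //.
      by rewrite mul1n.
    move/(dvdn_leq Y0); move: d1 YH Hn n0; move: (_ %/ _); clear; lia.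
  move/negP: nrel; apply; apply: (mem_related X0 XH YH eH).
  by rewrite -E; ring.
have cnt : count P (iota 0 w) <= (w %/ (2 * n * m)).+1 * (2 * (m %/ (n * k))).+1 * k.
  have [uyx|uxy] := leqP `|uy| `|ux|.
    have uxm : `|ux| = m by rewrite -uM (maxn_idPl _).
    by apply: (count_common_near_aux _ n0 w0 m0 uL uxm) => //; rewrite -uxm.
  have uym : `|uy| = m by rewrite -uM (maxn_idPr (ltnW uxy)).
  rewrite (eq_count (a2 := predI (near_nonmult n w w2) (near_nonmult n w w1))); last first.
    by move=> z; rewrite /= andbC.
  apply: (count_common_near_aux _ n0 w0 m0 (mult_latticeC uL) uym) => //.
  - by rewrite [gcdn w2 _]gcdnC.
  - by rewrite -uym ltnW.
  by move=> X' Y' /mult_latticeC h hX hY; have [] := umin _ _ h hY hX.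
apply: leq_trans (leq_mul (leqnn _) cnt) _.
have nm0 : 0 < 2 * n * m by rewrite !muln_gt0 n0.
have C1 : 1 <= w %/ (2 * n * m) by rewrite leq_divRL // mul1n.
have C2 : w %/ (2 * n * m) * (2 * n * m) <= w by exact: leq_trunc_div.
have F1 : m %/ (n * k) * (n * k) <= m by exact: leq_trunc_div.
move: (w %/ _) (m %/ _) C1 C2 F1 => C F C1 C2 F1.
apply: leq_trans (_ : C * 2 * (2 * H * (F * (n * k)) + n * (H * k)) <= _).
  rewrite (_ : C * 2 * _ = n * H * (C * 2 * (2 * F).+1 * k)); last by ring.
  by rewrite !leq_mul //; move: C1; clear; lia.
(* The first term is at most [n m] by [2 H <= n] and [F n k <= m], the second by [H k < m]. *)
apply: leq_trans (_ : C * 2 * (n * m + n * m) <= _).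
  by rewrite leq_mul // leq_add // leq_mul // ltnW.
by move: C2; clear; lia.
Qed.

Lemma count_has_le (T S : Type) (P : T -> pred S) (l : seq T) (s : seq S) :
  count (fun b => has (P^~ b) l) s <= \sum_(x <- l) count (P x) s.
Proof.
elim: l => [|x l IH] /=; first by rewrite big_nil count_pred0.
rewrite big_cons; apply: leq_trans (leq_add (leqnn (count (P x) s)) IH).
by rewrite -count_predUI leq_addr.
Qed.

(* Only [O(T ^ 3)] speeds are related to a given one, so [8 T + 1] pairwise
   unrelated speeds can be chosen greedily; their sets [near_nonmult] are
   nearly disjoint. *)
Lemma size_far_mult_le n w T (G : seq nat) : 0 < n -> 0 < w -> uniq G ->
  {in G, forall w', w' < w /\ 2 * n < w %/ gcdn w w'} ->
  32 * (8 * T).+1 <= n ->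
  n * count (fun b => has (near_mult n w ^~ b) G) (iota 0 w) <= T * w ->
  size G <= (8 * T).+1 * (2 ^ 18 * (8 * T).+1 ^ 3).
Proof.
move=> n0 w0 uG GP; set s := (8 * T).+1 => sn cntG; pose H := 16 * s.
have sB w1 : size (related H w w1) <= 2 ^ 18 * s ^ 3.
  by rewrite size_related /H; move: (ltn0Sn (8 * T)); rewrite -/s; clear; nia.
rewrite leqNgt; apply/negP => big.
have [l [sl lG h]] : exists l, [/\ size l = s, {subset l <= G} &
    s * w <= 8 * n * count (fun b => has (near_nonmult n w ^~ b) l) (iota 0 w)]; last first.
  have : count (fun b => has (near_nonmult n w ^~ b) l) (iota 0 w) <=
    count (fun b => has (near_mult n w ^~ b) G) (iota 0 w).
    apply: sub_count => b /hasP [x xl /andP [_ xb]]; apply/hasP; exists x => //.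
    exact: lG.
  move=> le; have : s * w <= 8 * T * w.
    apply: (leq_trans h); rewrite -!mulnA leq_mul2l /=; apply: leq_trans cntG.
    by rewrite leq_mul2l le orbT.
  by rewrite leq_pmul2r // ltnn.
suff : forall r, r <= s -> exists l, [/\ size l = r, {subset l <= G} &
    r * w <= 8 * n * count (fun b => has (near_nonmult n w ^~ b) l) (iota 0 w)].
  by apply.
elim=> [_|r IH rs]; first by exists [::].
have [l [sl lG lc]] := IH (ltnW rs).
have [w2 w2G w2l] : exists2 w2, w2 \in G & w2 \notin flatten (map (related H w) l).
  apply/hasP; rewrite -[has _ _]negbK -all_predC; apply/negP => /allP h.
  have : size G <= size (flatten (map (related H w) l)).
    by apply: uniq_leq_size => // x /h; rewrite /= negbK.
  apply/negP; rewrite -ltnNge; apply: leq_ltn_trans big.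
  rewrite size_flatten /shape -map_comp sumnE big_map.
  apply: (@leq_trans (\sum_(i <- l) (2 ^ 18 * s ^ 3))).
    by apply: leq_sum => i _; exact: sB.
  by rewrite big_const_seq count_predT iter_addn_0 sl mulnC leq_mul // ltnW.
exists (w2 :: l); split; first by rewrite /= sl.
  by move=> x; rewrite inE => /orP [/eqP ->|/lG].
have [w2w w2d] := GP _ w2G.
set A := near_nonmult n w w2; pose B b := has (near_nonmult n w ^~ b) l.
rewrite (@eq_count _ _ (predU A B)) //.
have cA := count_near_nonmult_ge n0 w0 w2d.
(* The new set has at least [w / 4n] elements and, since [H = 16 s], shares at most
   [r * 2 w / (n H) <= w / 8n] of them with the [r < s] earlier ones. *)
have cI : 8 * n * count (predI A B) (iota 0 w) <= w.
  have cI1 : count (predI A B) (iota 0 w) <= \sum_(w1 <- l)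
      count (predI (near_nonmult n w w1) (near_nonmult n w w2)) (iota 0 w).
    apply: leq_trans (count_has_le
      (fun w1 => predI (near_nonmult n w w1) (near_nonmult n w w2)) l (iota 0 w)).
    apply: sub_count => b /andP [Ab /hasP [x xl xb]]; apply/hasP; exists x => //=.
    by rewrite xb.
  have s0 : 0 < 2 * s by [].
  rewrite -(leq_pmul2l s0); apply: leq_trans (leq_mul (leqnn _) (leq_mul (leqnn _) cI1)) _.
  rewrite mulnA (_ : 2 * s * (8 * n) = n * H); last by rewrite /H; ring.
  rewrite big_distrr /= big_seq.
  apply: leq_trans (_ : \sum_(i <- l | i \in l) (2 * w) <= _).
    apply: leq_sum => w1 w1l; have [w1w w1d] := GP _ (lG _ w1l).
    apply: count_common_near => //; first by rewrite /H mulnA.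
    apply: contra w2l => h; apply/flattenP; exists (related H w w1) => //.
    exact: map_f.
  rewrite -big_seq big_const_seq count_predT iter_addn_0 sl; move: rs; clear; nia.
have cU := count_predUI A B (iota 0 w).
move: lc cA cI cU; rewrite -/(B) -/A.
move: (count (predU A B) _) (count (predI A B) _) (count A _) => cU cI cA.
rewrite -/(B); move: (count _ _) => cB; clear; nia.
Qed.

(** * Density of a union of sets of multiples *)

Lemma count_multiples (Q : pred nat) p M : 0 < p ->
  count (fun r => (p %| r) && Q r) (iota 0 (p * M)) = count (fun r => Q (p * r)) (iota 0 M).
Proof.
move=> p0; elim: M => [|M IH]; first by rewrite muln0.
rewrite mulnS addnC iotaD count_cat IH add0n -addn1 iotaD count_cat; congr (_ + _).
rewrite add0n -[p in iota _ p](prednK p0) /= dvdn_mulr //= addn0.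
rewrite (@eq_in_count _ _ pred0) ?count_pred0 ?addn0 // => r.
rewrite mem_iota => h; apply/negbTE; rewrite negb_and; apply/orP; left.
apply/negP => /dvdnP [q qE]; move: h; rewrite qE [q * p]mulnC.
have [qM|qM] := leqP q M; have : p * q <= p * M \/ p * M.+1 <= p * q.
- by left; rewrite leq_mul2l qM orbT.
- by move=> [] h; move: h p0; rewrite ?mulnS; move: qM; clear; nia.
- by right; rewrite leq_mul2l qM orbT.
by move=> [] h; move: h p0; rewrite ?mulnS; move: qM; clear; nia.
Qed.

Section UnionOfMultiples.
Local Open Scope ring_scope.
Variable R : realFieldType.

(** Legendre's sieve, exact since every prime of [S] divides [N]. Among the survivors of the other
    primes, the multiples of [p] correspond to the survivors below [N / p], which yields the factor
    [1 - 1 / p]. *)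
Lemma count_not_dvd_primes (S : seq nat) N : (0 < N)%N -> uniq S -> all prime S ->
  all (fun p => p %| N)%N S ->
  (count (fun r => all (fun p => ~~ (p %| r)%N) S) (iota 0 N))%:R =
    N%:R * \prod_(p <- S) (1 - p%:R^-1) :> R.
Proof.
elim: S N => [|p S IH] N N0; first by rewrite big_nil mulr1 count_predT size_iota.
move=> /= /andP [pS uS] /andP [pp aS] /andP [pN aN].
have p0 := prime_gt0 pp.
have NE : N = (p * (N %/ p))%N by rewrite mulnC divnK.
pose A r := all (fun p => ~~ (p %| r)%N) S.
have M0 : (0 < N %/ p)%N by rewrite divn_gt0 // dvdn_leq.
have cE : (count A (iota 0 N) = count A (iota 0 (N %/ p)) +
    count (fun r => all (fun p => ~~ (p %| r)%N) (p :: S)) (iota 0 N))%N.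
  have -> : count A (iota 0 (N %/ p)) = count (fun r => (p %| r)%N && A r) (iota 0 N).
    rewrite [in RHS]NE count_multiples //; apply: eq_in_count => r _.
    apply: eq_in_all => q qS; have pq := allP aS _ qS.
    rewrite Euclid_dvdM //; case: (boolP (q %| p)%N) => //.
    by rewrite dvdn_prime2 // => /eqP qp; rewrite -qp qS in pS.
  elim: (iota 0 N) => //= r s ->; rewrite -/(A r).
  by case: (p %| r)%N; case: (A r) => /=; rewrite ?addnS ?addSn.
have := congr1 (fun x : nat => x%:R : R) cE; rewrite natrD.
rewrite (IH _ N0 uS aS aN) (IH _ M0 uS aS); last first.
  apply/allP => q qS; have pq := allP aS _ qS; have := allP aN _ qS.
  rewrite [in X in X -> _]NE Euclid_dvdM // dvdn_prime2 // => /orP [/eqP qp|//].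
  by rewrite -qp qS in pS.
have p0' : p%:R != 0 :> R by rewrite pnatr_eq0 -lt0n.
rewrite big_cons {1}NE natrM => /(canLR (addKr _)) <- /=.
by rewrite [in RHS]NE natrM; field.
Qed.

(* Attach each [b] to the largest [d] in [D] dividing it: [b = d r] is attached
   to [d] as soon as [r] avoids one prime factor of [d' / gcd (d, d')] for each
   larger [d']. *)
Lemma count_union_multiples (D : seq nat) w K (rho : R) : (0 < w)%N ->
  sorted ltn D -> all (fun d => d %| w)%N D -> (size D <= K)%N ->
  (forall S : seq nat, uniq S -> all prime S -> (size S <= K)%N ->
     rho <= \prod_(p <- S) (1 - p%:R^-1)) ->
  \sum_(d <- D) w%:R / d%:R * rho <=
    (count (fun b => has (fun d => d %| b)%N D) (iota 0 w))%:R.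
Proof.
move=> w0 sD aD sK hrho.
elim: D sD aD sK => [|d D IH]; first by rewrite big_nil.
move=> /= pD /andP [dw aD] sK.
have sD := path_sorted pD.
have ltD := order_path_min ltn_trans pD.
have d0 : (0 < d)%N by rewrite (dvdn_gt0 w0).
rewrite big_cons; set B := fun b => has (fun d => d %| b)%N D.
have cE : (count (fun b => (d %| b) || B b) (iota 0 w) =
    count (fun b => (d %| b) && ~~ B b) (iota 0 w) + count B (iota 0 w))%N.
  elim: (iota 0 w) => //= r s ->.
  by case: (d %| r)%N; case: (B r) => /=; rewrite ?addnS ?addSn.
rewrite cE natrD lerD //; last by apply: IH => //; exact: ltnW.
have wE : w = (d * (w %/ d))%N by rewrite mulnC divnK.
pose q d' := (d' %/ gcdn d d')%N.
pose S := undup [seq pdiv (q d') | d' <- D].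
have q1 d' : d' \in D -> (1 < q d')%N.
  move=> dD; have dd := allP ltD _ dD; have g0 : (0 < gcdn d d')%N by rewrite gcdn_gt0 d0.
  by rewrite ltn_divRL ?dvdn_gcdr // mul1n (leq_ltn_trans _ dd) // dvdn_leq // dvdn_gcdl.
have qw d' : d' \in D -> (q d' %| w %/ d)%N.
  move=> dD; have g0 : (0 < gcdn d d')%N by rewrite gcdn_gt0 d0.
  rewrite dvdn_divRL // /q -(dvdn_pmul2r g0).
  have d'w := allP aD _ dD.
  rewrite mulnAC divnK ?dvdn_gcdr // muln_gcdr dvdn_gcd dvdn_mul //=.
  by rewrite mulnC dvdn_mul.
have SP : all prime S.
  by apply/allP => p; rewrite mem_undup => /mapP [d' dD ->]; rewrite pdiv_prime // q1.
have Sw : all (fun p => p %| w %/ d)%N S.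
  apply/allP => p; rewrite mem_undup => /mapP [d' dD ->].
  by apply: dvdn_trans (pdiv_dvd _) _; exact: qw.
have M0 : (0 < w %/ d)%N by rewrite divn_gt0 // dvdn_leq.
apply: (@le_trans _ _ ((w %/ d)%N%:R * \prod_(p <- S) (1 - p%:R^-1))).
  have -> : w%:R / d%:R = (w %/ d)%N%:R :> R.
    by rewrite {1}wE natrM mulrC mulKf // pnatr_eq0 -lt0n.
  rewrite ler_wpM2l ?ler0n // hrho ?undup_uniq //.
  by rewrite (leq_trans (size_undup _)) // size_map ltnW.
rewrite -count_not_dvd_primes ?undup_uniq // [in X in _ <= X]wE count_multiples // ler_nat.
apply: sub_count => r /allP h; apply/hasPn => d' dD; apply/negP => dr.
have g0 : (0 < gcdn d d')%N by rewrite gcdn_gt0 d0.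
have : (q d' %| r)%N.
  have : (q d' %| (d %/ gcdn d d') * r)%N.
    rewrite /q -(dvdn_pmul2r g0) divnK ?dvdn_gcdr // mulnAC divnK ?dvdn_gcdl //.
  rewrite Gauss_dvdr // /q /coprime -(eqn_pmul2r g0) muln_gcdl !divnK ?dvdn_gcdl ?dvdn_gcdr //.
  by rewrite mul1n gcdnC.
move=> qr; have pS : pdiv (q d') \in S by rewrite mem_undup; apply/mapP; exists d'.
by have := h _ pS; rewrite (dvdn_trans (pdiv_dvd _) qr).
Qed.
End UnionOfMultiples.

(** * Mertens' product *)

(** For distinct primes these are the squarefree integers with all prime factors in [l], the
    denominators in the expansion of the product of [1 + 1 / p]. *)
Fixpoint subset_prods (l : seq nat) : seq nat :=
  if l is p :: l' then subset_prods l' ++ [seq (p * m)%N | m <- subset_prods l']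
  else [:: 1%N].

Lemma mem_subset_prods l m : all prime l -> m \in subset_prods l ->
  (0 < m)%N /\ forall q, prime q -> (q %| m)%N -> q \in l.
Proof.
elim: l m => [|p l IH] m /=.
  by move=> _; rewrite inE => /eqP ->; split=> // q pq; rewrite Euclid_dvd1.
move=> /andP [pp al]; rewrite mem_cat => /orP [/IH []//|/mapP [m' /IH [] // m'0 h ->]].
  by move=> m0 h; split => // q pq /(h _ pq); rewrite inE => ->; rewrite orbT.
split; first by rewrite muln_gt0 prime_gt0.
move=> q pq; rewrite Euclid_dvdM // dvdn_prime2 // inE => /orP [-> //|/(h _ pq) ->].
by rewrite orbT.
Qed.

Lemma subset_prods_uniq l : uniq l -> all prime l -> uniq (subset_prods l).
Proof.
elim: l => [//|p l IH] /= /andP [pl ul] /andP [pp al].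
have p0 := prime_gt0 pp.
rewrite cat_uniq IH //= map_inj_uniq ?IH ?andbT //; last first.
  by move=> a b /eqP; rewrite eqn_pmul2l // => /eqP.
apply/hasPn => _ /mapP [m _ ->]; apply/negP => /(mem_subset_prods al) [_] /(_ p pp).
by rewrite dvdn_mulr // => /(_ isT); rewrite (negbTE pl).
Qed.

Section Mertens.
Local Open Scope ring_scope.
Variable R : realType.

Lemma ln_nat_gt0 y : (2 <= y)%N -> 0 < ln (y%:R : R).
Proof. by move=> y2; rewrite ln_gt0 // ltr1n. Qed.

Lemma ln2_ge : 2^-1 <= ln 2 :> R.
Proof.
have := @le_ln1Dx R (- 2^-1); rewrite (_ : 1 + - 2^-1 = 2^-1); last lra.
rewrite lnV ?posrE // => /(_ _); lra.
Qed.

Lemma harmonic_le N : (0 < N)%N ->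
  \sum_(1 <= m < N.+1) (m%:R)^-1 <= 1 + ln (N%:R : R).
Proof.
case: N => // N _; elim: N => [|N IH]; first by rewrite big_nat1 invr1 ln1 addr0.
rewrite big_nat_recr //=.
have := @le_ln1Dx R (- (N.+2%:R)^-1).
have N2 : 0 < N.+2%:R :> R by rewrite ltr0n.
have N1 : 0 < N.+1%:R :> R by rewrite ltr0n.
have -> : 1 + - (N.+2%:R)^-1 = N.+1%:R / N.+2%:R :> R.
  move: N2; rewrite -natr1; move: (N.+1%:R) => a a1.
  by field; exact: lt0r_neq0.
rewrite ln_div ?posrE //.
have h : -1 < - (N.+2%:R)^-1 :> R.
  by rewrite ltrN2 invf_lt1 // ltr1n.
move=> /(_ h); move: IH; set a := ln N.+1%:R; set b := ln N.+2%:R; set x := _^-1.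
by move: a b x (\sum_(_ <= _ < _) _) => a b x S; clear; lra.
Qed.

Definition primes_upto y := [seq p <- iota 1 y | prime p].

(** Half of Mertens' first theorem. For [m <= N = y ^ 2] the sum of [ln p] over primes [p <= y]
    dividing [m] is at most [ln m <= ln N], and each such [p] divides at least [N / 2p] of the [m];
    hence the bound [2 ln N]. *)
Lemma sum_ln_primes_le y : (2 <= y)%N ->
  \sum_(p <- primes_upto y) ln (p%:R : R) / p%:R <= 4 * ln y%:R.
Proof.
move=> y2; pose N := (y * y)%N.
have N0 : (0 < N)%N by rewrite muln_gt0; lia.
have y0 : 0 < y%:R :> R by rewrite ltr0n; lia.
have PP p : p \in primes_upto y -> prime p /\ (p <= y)%N.
  by rewrite mem_filter mem_iota => /andP [-> /andP [_ h]]; split => //; lia.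
have h1 : \sum_(1 <= m < N.+1) \sum_(p <- primes_upto y) (p %| m)%:R * ln p%:R <=
    \sum_(1 <= m < N.+1) ln (N%:R : R).
  rewrite !big_seq; apply: ler_sum => m; rewrite mem_index_iota => /andP [m0 mN].
  have -> : \sum_(p <- primes_upto y) (p %| m)%:R * ln (p%:R : R) =
      ln (\prod_(p <- [seq p <- primes_upto y | (p %| m)%N]) p)%:R.
    have : {in primes_upto y, forall p, (0 < p)%N}.
      by move=> p /PP [/prime_gt0].
    elim: (primes_upto y) => [|p l IH] lP; first by rewrite !big_nil ln1.
    have p0 : (0 < p)%N by apply: lP; rewrite inE eqxx.
    have {}IH := IH (fun q ql => lP q (mem_behead (s := p :: l) ql)).
    rewrite big_cons IH /=; case: (p %| m)%N; rewrite ?mul0r ?add0r // mul1r big_cons natrM.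
    rewrite lnM // posrE ltr0n //.
    rewrite big_seq; apply: prodn_cond_gt0 => q; rewrite mem_filter => /andP [_ ql].
    by apply: lP; rewrite inE ql orbT.
  have dv : (\prod_(p <- [seq p <- primes_upto y | (p %| m)%N]) p %| m)%N.
    apply: prod_primes_dvd; first by rewrite !filter_uniq ?iota_uniq.
      by apply/allP => p; rewrite mem_filter => /andP [_ /PP []].
    exact: filter_all.
  have d0 := dvdn_gt0 m0 dv; have d1 := dvdn_leq m0 dv.
  by rewrite ler_ln ?posrE ?ltr0n // ler_nat; lia.
rewrite exchange_big /= sumr_const_nat subn1 /= in h1.
have h2 : \sum_(p <- primes_upto y) N%:R / (2 * p%:R) * ln (p%:R : R) <=
    ln (N%:R : R) *+ N.
  apply: le_trans h1; rewrite !big_seq; apply: ler_sum => p /PP [pp py].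
  have p1 := prime_gt1 pp.
  rewrite -mulr_suml ler_wpM2r ?ln_ge0 ?ler1n ?prime_gt0 //.
  rewrite -natr_sum -divn_count_dvd ler_pdivrMr ?mulr_gt0 ?ltr0n ?prime_gt0 //.
  rewrite -!natrM ler_nat.
  have k1 : (1 <= N %/ p)%N by rewrite divn_gt0 /N; nia.
  have := ltn_ceil N (prime_gt0 pp); move: (N %/ p)%N k1 => k; nia.
rewrite -(ler_pM2l (_ : 0 < N%:R / 2 :> R)) ?divr_gt0 ?ltr0n //.
rewrite mulr_sumr; apply: le_trans (_ : _ <= ln (N%:R : R) *+ N) _.
  apply: le_trans h2; rewrite !big_seq; apply: ler_sum => p /PP [pp _].
  have p0 : p%:R != 0 :> R by rewrite pnatr_eq0 -lt0n prime_gt0.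
  by rewrite le_eqVlt; apply/orP; left; apply/eqP; field.
by rewrite -[ln _ *+ _]mulr_natr /N natrM lnM ?posrE //; clear; lra.
Qed.

Lemma prod_1D_inv_subset_prods l :
  \prod_(p <- l) (1 + p%:R^-1) = \sum_(m <- subset_prods l) (m%:R : R)^-1.
Proof.
elim: l => [|p l IH] /=; first by rewrite big_nil big_seq1 invr1.
rewrite big_cons IH big_cat big_map /= mulrDl mul1r mulr_sumr; congr (_ + _).
by apply: eq_bigr => m _; rewrite natrM invfM.
Qed.

(** Under the weights [1 / m], the prime [p] divides [m] with probability
    [(1 / p) / (1 + 1 / p) <= 1 / p], so the mean of [ln m] is at most the sum of [ln p / p]. *)
Lemma sum_ln_subset_prods l : all prime l ->
  \sum_(m <- subset_prods l) ln (m%:R : R) / m%:R <=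
    (\prod_(p <- l) (1 + p%:R^-1)) * \sum_(p <- l) ln (p%:R : R) / p%:R.
Proof.
elim: l => [|p l IH] /=; first by rewrite big_nil big_seq1 ln1 mul0r big_nil mulr0.
move=> /andP [pp al]; have {}IH := IH al.
have p0 : 0 < p%:R :> R by rewrite ltr0n prime_gt0.
rewrite !big_cons big_cat big_map /=.
have -> : \sum_(j <- subset_prods l) ln ((p * j)%:R : R) / (p * j)%:R =
   ln p%:R / p%:R * (\prod_(p <- l) (1 + p%:R^-1)) +
   p%:R^-1 * \sum_(m <- subset_prods l) ln (m%:R : R) / m%:R.
  rewrite prod_1D_inv_subset_prods !mulr_sumr -big_split /= !big_seq.
  apply: eq_bigr => m /(mem_subset_prods al) [m0 _].
  have m0' : 0 < m%:R :> R by rewrite ltr0n.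
  by rewrite natrM lnM ?posrE //; field; rewrite !lt0r_neq0.
set Z := \prod_(j <- l) _ in IH *; set B := \sum_(j <- l) _ in IH *; set A := \sum_(i <- _) _ in IH *.
have Z0 : 0 <= Z by apply: prodr_ge0 => q _; rewrite addr_ge0 ?invr_ge0.
have pV : 0 < p%:R^-1 :> R by rewrite invr_gt0.
have lp : 0 <= ln (p%:R : R) by rewrite ln_ge0 // ler1n prime_gt0.
have : 0 <= ln p%:R / p%:R * Z * p%:R^-1 by rewrite !mulr_ge0 // ltW.
have : (1 + p%:R^-1) * A <= (1 + p%:R^-1) * (Z * B).
  by rewrite ler_wpM2l // addr_ge0 // ltW.
by clear IH Z0; move: (p%:R^-1) @Z @B @A (ln p%:R) => x Z B A y; clear; nra.
Qed.

Lemma sum_inv_uniq_le (s : seq nat) X : uniq s -> {in s, forall m, 0 < m <= X}%N ->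
  \sum_(m <- s) (m%:R : R)^-1 <= \sum_(1 <= m < X.+1) (m%:R)^-1.
Proof.
move=> us sX; rewrite [leRHS](bigID (mem s)) /= -[leLHS]addr0 lerD //; last first.
  by apply: sumr_ge0 => m _; rewrite invr_ge0.
rewrite -[leRHS]big_filter (perm_big [seq i <- index_iota 1 X.+1 | i \in s]) //=.
apply: uniq_perm; rewrite ?filter_uniq ?iota_uniq // => m.
rewrite mem_filter mem_index_iota; case: (boolP (m \in s)) => //= /sX /andP [-> h].
by rewrite ltnS h.
Qed.

(* Give the product [m] of a random set of primes the weight [1/m]: the mean of
   [ln m] is at most [4 ln y], so by Markov's inequality half of the total
   weight sits on [m <= y ^ 8]. *)
Lemma prod_1D_inv_primes_le y : (2 <= y)%N ->
  \prod_(p <- primes_upto y) (1 + (p%:R : R)^-1) <= 20 * ln y%:R.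
Proof.
move=> y2; set l := primes_upto y.
have al : all prime l by exact: filter_all.
have ul : uniq l by rewrite filter_uniq ?iota_uniq.
set Z := \prod_(p <- l) _.
have ly := ln_nat_gt0 y2.
have y0 : 0 < y%:R :> R by rewrite ltr0n; lia.
have h1 : Z * (4 * ln y%:R) >= \sum_(m <- subset_prods l) ln (m%:R : R) / m%:R.
  apply: le_trans (sum_ln_subset_prods al) _; rewrite ler_wpM2l ?sum_ln_primes_le //.
  by apply: prodr_ge0 => q _; rewrite addr_ge0 ?invr_ge0.
have h2 : Z <= \sum_(m <- [seq m <- subset_prods l | (m <= y ^ 8)%N]) (m%:R : R)^-1 +
    (8 * ln y%:R)^-1 * \sum_(m <- subset_prods l) ln (m%:R : R) / m%:R.
  rewrite /Z prod_1D_inv_subset_prods big_filter [X in _ <= X + _]big_mkcond mulr_sumr -big_split /=.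
  rewrite !big_seq; apply: ler_sum => m /(mem_subset_prods al) [m0 _].
  have m0' : 0 < m%:R :> R by rewrite ltr0n.
  have lm : 0 <= ln (m%:R : R) by rewrite ln_ge0 // ler1n.
  case: leqP => my.
    by rewrite lerDl !mulr_ge0 ?invr_ge0 ?mulr_ge0 // ltW.
  rewrite add0r mulrA ler_peMl ?invr_ge0 ?ler0n // mulrC.
  rewrite ler_pdivlMr ?mulr_gt0 // mul1r.
  have : ln ((y ^ 8)%:R : R) <= ln m%:R.
    by rewrite ler_ln ?posrE ?ltr0n ?expn_gt0 ?(ltnW y2) ?ler_nat ?(ltnW my) //; lia.
  by rewrite natrX lnXn // -[ln _ *+ _]mulr_natl.
have h3 : \sum_(m <- [seq m <- subset_prods l | (m <= y ^ 8)%N]) (m%:R : R)^-1 <=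
    1 + 8 * ln y%:R.
  have -> : 8 * ln y%:R = ln ((y ^ 8)%:R : R) by rewrite natrX lnXn // -[ln _ *+ _]mulr_natl.
  apply: le_trans (harmonic_le _); last by rewrite expn_gt0; lia.
  apply: sum_inv_uniq_le; first by rewrite filter_uniq // subset_prods_uniq.
  by move=> m; rewrite mem_filter => /andP [-> /(mem_subset_prods al) [-> _]].
have h4 : (8 * ln y%:R)^-1 * \sum_(m <- subset_prods l) ln (m%:R : R) / m%:R <= Z / 2.
  rewrite mulrC ler_pdivrMr ?mulr_gt0 //; apply: le_trans h1 _; lra.
(* Now [Z <= 2 (1 + 8 ln y)], and the constant is absorbed through [ln y >= ln 2 >= 1 / 2]. *)
have : ln 2 <= ln (y%:R : R) by rewrite ler_ln ?posrE // ler_nat.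
have := ln2_ge; lra.
Qed.

(** The same product over all integers from 2 to [y] telescopes to [(y + 1) / 2y]; restricting it to
    primes can only increase it. *)
Lemma prod_1B_inv_sqr_ge y : (1 <= y)%N ->
  2^-1 <= \prod_(p <- primes_upto y) (1 - (p%:R : R)^-1 ^+ 2).
Proof.
move=> y1; rewrite /primes_upto big_filter.
suff : (y.+1)%:R / (2 * y%:R) <= \prod_(p <- iota 1 y | prime p) (1 - (p%:R : R)^-1 ^+ 2).
  apply: le_trans; rewrite ler_pdivlMr ?mulr_gt0 ?ltr0n //.
  by rewrite mulKf ?pnatr_eq0 ?ler_nat.
case: y y1 => // y _; elim: y => [|y IH].
  by rewrite /= big_cons big_nil /=; lra.
rewrite (_ : iota 1 y.+2 = iota 1 y.+1 ++ [:: y.+2]); last first.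
  by rewrite -[in LHS](addn1 y.+1) iotaD.
have P0 : 0 <= \prod_(p <- iota 1 y.+1 | prime p) (1 - (p%:R : R)^-1 ^+ 2).
  apply: prodr_ge0 => p pp.
  by rewrite subr_ge0 expr_le1 ?invr_ge0 // invf_le1 ?ler1n ?ltr0n prime_gt0.
rewrite big_cat; set P := \prod_(p <- iota 1 y.+1 | prime p) _ in IH P0 *.
rewrite big_cons big_nil /=.
have y0 : 0 < y.+1%:R :> R by rewrite ltr0n.
have y20 : 0 < y.+2%:R :> R by rewrite ltr0n.
have c0 : 0 < 1 - (y.+2%:R : R)^-1 ^+ 2.
  by rewrite subr_gt0 expr_lt1 ?invr_ge0 // invf_lt1 // ltr1n.
have e : (y.+3)%:R / (2 * y.+2%:R) =
    (y.+2)%:R / (2 * y.+1%:R) * (1 - (y.+2%:R : R)^-1 ^+ 2).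
  move: y0 y20; rewrite -[y.+3%:R]natr1 -[y.+2%:R]natr1; move: (y.+1%:R) => a y0 y20.
  by field; rewrite !lt0r_neq0.
apply: (@le_trans _ _ ((y.+2)%:R / (2 * y.+1%:R) * (1 - (y.+2%:R : R)^-1 ^+ 2))).
  by rewrite e.
apply: le_trans (ler_wpM2r (ltW c0) IH) _.
rewrite ler_wpM2l //.
by case: ifP => _; rewrite ?mulr1 // gerBl exprn_ge0 // invr_ge0.
Qed.

Lemma prod_1B_inv_primes_ge y : (2 <= y)%N ->
  (40 * ln y%:R)^-1 <= \prod_(p <- primes_upto y) (1 - (p%:R : R)^-1).
Proof.
move=> y2; have ly := ln_nat_gt0 y2.
have h1 := prod_1D_inv_primes_le y2.
have h2 := prod_1B_inv_sqr_ge (ltnW y2).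
set A := \prod_(p <- _) _; set B := \prod_(p <- _) _ in h1; set C := \prod_(p <- _) _ in h2.
have CE : C = A * B.
  by rewrite /A /B /C -big_split /=; apply: eq_bigr => p _; rewrite -subr_sqr expr1n.
have A0 : 0 <= A.
  rewrite /A big_seq; apply: prodr_ge0 => p; rewrite mem_filter => /andP [pp _].
  by rewrite subr_ge0 invf_le1 ?ler1n ?ltr0n prime_gt0.
rewrite -[leLHS]mul1r ler_pdivrMr ?mulr_gt0 //.
have : A * B <= A * (20 * ln y%:R) by rewrite ler_wpM2l.
rewrite -CE; lra.
Qed.

Lemma prod_1B_ge (s : seq nat) (F : nat -> R) : {in s, forall i, 0 <= F i <= 1} ->
  1 - \sum_(i <- s) F i <= \prod_(i <- s) (1 - F i).
Proof.
elim: s => [|i s IH] sF; first by rewrite !big_nil subr0.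
rewrite !big_cons; have /andP [F0 F1] := sF i (mem_head _ _).
have {}IH := IH (fun q ql => sF q (mem_behead (s := i :: s) ql)).
have S0 : 0 <= \sum_(i <- s) F i.
  rewrite big_seq; apply: sumr_ge0 => j js.
  by have /andP [] := sF j (mem_behead (s := i :: s) js).
have : (1 - F i) * (1 - \sum_(i <- s) F i) <= (1 - F i) * \prod_(i <- s) (1 - F i).
  by rewrite ler_wpM2l // subr_ge0.
have : 0 <= F i * \sum_(i <- s) F i by rewrite mulr_ge0.
lra.
Qed.

Lemma prod_subset_ge (s t : seq nat) (F : nat -> R) : uniq s -> uniq t ->
  {subset s <= t} -> {in t, forall i, 0 <= F i <= 1} ->
  \prod_(i <- t) F i <= \prod_(i <- s) F i.
Proof.
move=> us ut st tF; rewrite (bigID (mem s)) /=.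
have -> : \prod_(i <- t | i \in s) F i = \prod_(i <- s) F i.
  rewrite -big_filter; apply: perm_big; apply: uniq_perm; rewrite ?filter_uniq // => i.
  by rewrite mem_filter; case: (boolP (i \in s)) => // /st ->.
rewrite ler_piMr //.
  by rewrite big_seq; apply: prodr_ge0 => i /st /tF /andP [].
by rewrite big_seq_cond; apply: prodr_ile1 => i /andP [/tF].
Qed.

(** The primes up to [2 K] are handled by Mertens' product; the at most [K] larger ones contribute
    at least [1 - K / 2K = 1 / 2]. *)
Lemma prod_1B_inv_few_primes_ge (S : seq nat) K : (2 <= K)%N -> uniq S -> all prime S ->
  (size S <= K)%N -> (160 * ln K%:R)^-1 <= \prod_(p <- S) (1 - (p%:R : R)^-1).
Proof.
move=> K2 uS aS sK; have K0 : (0 < K)%N by lia.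
have K0' : 0 < K%:R :> R by rewrite ltr0n.
have lK := ln_nat_gt0 K2.
have pF p : prime p -> 0 <= 1 - (p%:R : R)^-1 <= 1.
  move=> pp; have p0 := prime_gt0 pp.
  by apply/andP; split; rewrite ?gerBl ?invr_ge0 // subr_ge0 invf_le1 ?ltr0n ?ler1n.
rewrite (bigID (fun p => p <= 2 * K)%N) /=.
have h1 : (80 * ln K%:R)^-1 <= \prod_(p <- S | (p <= 2 * K)%N) (1 - (p%:R : R)^-1).
  apply: le_trans (_ : (40 * ln (2 * K)%N%:R)^-1 <= _).
    have l2 := ln_nat_gt0 (_ : 2 <= 2 * K)%N; rewrite lef_pV2 ?posrE ?mulr_gt0 ?l2 //; try lia.
    rewrite natrM lnM ?posrE //.
    have : ln 2 <= ln (K%:R : R) by rewrite ler_ln ?posrE // ler_nat.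
    lra.
  apply: le_trans (prod_1B_inv_primes_ge _) _; first by lia.
  rewrite -[leRHS]big_filter; apply: prod_subset_ge; rewrite ?filter_uniq ?iota_uniq //.
    move=> p; rewrite !mem_filter mem_iota => /andP [pK pS].
    by have pp := allP aS _ pS; rewrite pp prime_gt0 //= add1n ltnS.
  by move=> p; rewrite mem_filter => /andP [pp _]; exact: pF.
have h2 : 2^-1 <= \prod_(p <- S | ~~ (p <= 2 * K)%N) (1 - (p%:R : R)^-1).
  rewrite -big_filter; apply: le_trans (prod_1B_ge _); last first.
    move=> p; rewrite mem_filter => /andP [_ /(allP aS) pp]; have p0 := prime_gt0 pp.
    by rewrite invr_ge0 ler0n invf_le1 ?ltr0n ?ler1n.
  set S' := [seq i <- S | ~~ (i <= 2 * K)%N].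
  have : \sum_(i <- S') (i%:R : R)^-1 <= \sum_(i <- S') (2 * K%:R)^-1.
    rewrite !big_seq; apply: ler_sum => p; rewrite mem_filter -ltnNge => /andP [pK _].
    rewrite lef_pV2 ?posrE ?mulr_gt0 ?ltr0n //; last lia.
    by rewrite -natrM ler_nat ltnW.
  rewrite big_const_seq count_predT iter_addr_0 -[_ *+ size _]mulr_natr => h.
  have : (2 * K%:R)^-1 * (size S')%:R <= 2^-1 :> R.
    rewrite mulrC ler_pdivrMr ?mulr_gt0 // mulKf ?pnatr_eq0 // ler_nat.
    by rewrite size_filter (leq_trans (count_size _ _)).
  lra.
have -> : (160 * ln K%:R)^-1 = (80 * ln K%:R)^-1 * 2^-1 :> R.
  by rewrite -invfM; congr (_^-1); ring.
by apply: ler_pM => //; rewrite invr_ge0 // mulr_ge0 // ltW.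
Qed.

End Mertens.

(** * Good speeds *)

Lemma size_sum_fibers (T : Type) (U : eqType) (f : T -> U) (s : seq T) :
  size s = \sum_(d <- undup (map f s)) count (fun x => f x == d) s.
Proof.
have h (t : seq U) : uniq t -> \sum_(d <- t) count (fun x => f x == d) s =
    count (fun x => f x \in t) s.
  elim: t => [|d t IH] /=; first by rewrite big_nil -(@eq_count _ pred0) ?count_pred0.
  move=> /andP [dt ut]; rewrite big_cons IH //.
  elim: s {IH} => //= x s <-; rewrite inE.
  case: (eqVneq (f x) d) => [->|_] /=; last by rewrite !add0n addnCA.
  by rewrite (negbTE dt) addnACA.
rewrite h ?undup_uniq //; symmetry; apply/eqP; rewrite -all_count.
have := all_map f (mem (undup (map f s))) s; rewrite /preim /= => <-.
by apply/allP => z; rewrite /= mem_undup.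
Qed.

(** Only [w' < w] is allowed: a displacement of [t] by at most [delta / w] then changes [t w'] by
    less than [delta]. *)
Definition near_smaller n (G : seq nat) w b :=
  has (near_mult n w ^~ b) [seq w' <- G | w' < w].

Section Core.
Variables (n T : nat) (G : seq nat).
Hypotheses (n0 : 0 < n) (uG : uniq G) (G0 : {in G, forall w, 0 < w}).
Hypothesis GT : {in G, forall w, n * count (near_smaller n G w) (iota 0 w) <= T * w}.

Lemma dvd_near_mult w w' b : 0 < w -> w %/ gcdn w w' %| b -> near_mult n w w' b.
Proof.
move=> w0 h; rewrite /near_mult; have -> : (b * w') %% w = 0; last by rewrite muln0.
apply/eqP; rewrite -/(w %| b * w').
rewrite -(divnK (dvdn_gcdl w w')) dvdn_mul //; exact: dvdn_gcdr.
Qed.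

(** All multiples of [w1 / gcdn w1 w2] are counted for [w1], and there are [gcdn w1 w2] of them
    below [w1]. *)
Lemma gcdn_good_le w1 w2 : w1 \in G -> w2 \in G -> w2 < w1 -> n * gcdn w1 w2 <= T * w1.
Proof.
move=> h1 h2 lt; apply: leq_trans (GT h1); rewrite leq_mul //.
have w10 := G0 h1.
have g0 : 0 < gcdn w1 w2 by rewrite gcdn_gt0 w10.
have e0 : 0 < w1 %/ gcdn w1 w2 by rewrite divn_gt0 // dvdn_leq // dvdn_gcdl.
have := count_multiples predT (gcdn w1 w2) e0.
rewrite count_predT size_iota divnK ?dvdn_gcdl // => <-.
apply: sub_count => b; rewrite /= andbT => db.
apply/hasP; exists w2; first by rewrite mem_filter lt.
exact: dvd_near_mult.
Qed.

Section Type1.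
Variables (w : nat) (G1 : seq nat).
Hypotheses (wG : w \in G) (uG1 : uniq G1).
Hypothesis G1P : {in G1, forall w', [/\ w' \in G, w' < w & w %/ gcdn w w' <= 2 * n]}.
Let D := undup [seq w %/ gcdn w w' | w' <- G1].

(** For [K] of these denominators, all at most [2 n], the union of the multiples has density at
    least [K / 2n] times [1 / (160 ln K)], whereas [w] being good bounds it by [T / n]. *)
Lemma type1_denominators (R : realType) K : 2 <= K -> K <= size D ->
  (K%:R <= 320 * T%:R * ln (K%:R : R))%R.
Proof.
move=> K2 KD; have w0 := G0 wG.
have lK := ln_nat_gt0 R K2.
pose D1 := take K (sort leq D).
have sD1 : size D1 = K by rewrite size_takel // size_sort.
have D1P d : d \in D1 -> exists2 w', w' \in G1 & d = w %/ gcdn w w'.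
  by move/mem_take; rewrite mem_sort mem_undup => /mapP [w' h ->]; exists w'.
have h := @count_union_multiples R D1 w K (160 * ln K%:R)^-1%R w0 _ _ _ _.
have {}h : (\sum_(d <- D1) w%:R / d%:R * (160 * ln K%:R)^-1 <=
  (count (fun b => has (fun d => (d %| b)%N) D1) (iota 0 w))%:R :> R)%R.
  apply: h.
  - rewrite take_sorted // ltn_sorted_uniq_leq sort_uniq undup_uniq.
    exact: (sort_sorted leq_total).
  - by apply/allP => d /D1P [w' _ ->]; apply/dvdnP; exists (gcdn w w'); rewrite mulnC divnK ?dvdn_gcdl.
  - by rewrite sD1.
  - by move=> S uS aS sS; apply: prod_1B_inv_few_primes_ge.
have h1 : count (fun b => has (fun d => d %| b) D1) (iota 0 w) <=
    count (near_smaller n G w) (iota 0 w).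
  apply: sub_count => b /hasP [d /D1P [w' w'G ->] db]; have [h1 h2 _] := G1P w'G.
  by apply/hasP; exists w'; rewrite ?mem_filter ?h2 //; exact: dvd_near_mult.
have h2 := leq_trans (leq_mul (leqnn n) h1) (GT wG).
have n0' : (0 < n%:R :> R)%R by rewrite ltr0n.
have w0' : (0 < w%:R :> R)%R by rewrite ltr0n.
have h3 : (K%:R * (w%:R / (2 * n%:R) * (160 * ln K%:R)^-1) <=
   \sum_(d <- D1) w%:R / d%:R * (160 * ln K%:R)^-1 :> R)%R.
  set c := (w%:R / _ * _)%R.
  have -> : (K%:R * c = \sum_(d <- D1) c)%R.
    by rewrite big_const_seq count_predT iter_addr_0 sD1 mulr_natl.
  rewrite !big_seq.
  apply: ler_sum => d /D1P [w' w'G ->]; have [_ _ h3] := G1P w'G.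
  have d0 : 0 < w %/ gcdn w w'.
    by rewrite divn_gt0 ?gcdn_gt0 ?w0 // dvdn_leq // dvdn_gcdl.
  rewrite ler_wpM2r //; first by rewrite invr_ge0 mulr_ge0 // ltW.
  by rewrite ler_wpM2l // lef_pV2 ?posrE ?mulr_gt0 ?ltr0n // -natrM ler_nat.
have := le_trans h3 h; rewrite -(ler_pM2l n0') => h4.
have h5 : (n%:R * (count (fun b => has (fun d => (d %| b)%N) D1) (iota 0 w))%:R <=
  T%:R * w%:R :> R)%R by rewrite -!natrM ler_nat.
have := le_trans h4 h5.
have -> : (n%:R * (K%:R * (w%:R / (2 * n%:R) / (160 * ln K%:R))) =
  (w%:R / 320) * (K%:R / ln K%:R) :> R)%R by field; rewrite !lt0r_neq0.
have -> : (T%:R * w%:R = w%:R / 320 * (320 * T%:R) :> R)%R by field.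
rewrite ler_pM2l ?divr_gt0 // ler_pdivrMr //.
Qed.

(** For a fixed denominator [d] the speeds are [g a] with [g = w / d] and [a < d <= 2 n]. For
    [a' < a], [gcdn_good_le] gives [n gcdn a a' <= T a], so these gcds are at most [2 T] and
    [size_small_gcd] applies. *)
Lemma type1_size y : 2 * n < y * y -> size G1 <= size D *
  ((2 * T).+1 * y + (2 * T).+1 + \sum_(1 <= s < (2 * T).+1)
     count (fun p => prime p && (y <= p)) (iota 1 (2 * n %/ s))).
Proof.
move=> ny; have w0 := G0 wG.
rewrite (size_sum_fibers (fun w' => w %/ gcdn w w') G1) -/D.
set m := (X in _ <= _ * X).
apply: (@leq_trans (\sum_(d <- D) m)); last first.
  by rewrite big_const_seq count_predT iter_addn_0 mulnC.
rewrite !big_seq; apply: leq_sum => d; rewrite mem_undup => /mapP [w1 w1G dE].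
have [_ _ d2n] := G1P w1G; rewrite -dE in d2n.
pose g := gcdn w w1.
have g0 : 0 < g by rewrite gcdn_gt0 w0.
have wE : w = d * g by rewrite dE divnK // dvdn_gcdl.
have d0 : 0 < d by rewrite dE divn_gt0 // dvdn_leq // dvdn_gcdl.
pose F := [seq w' <- G1 | w %/ gcdn w w' == d].
have FP w' : w' \in F -> exists2 a, w' = g * a & [/\ 0 < a, a < d & w' \in G].
  rewrite mem_filter => /andP [/eqP e w'G].
  have [w'G' w'w _] := G1P w'G; have w'0 := G0 w'G'.
  have gE : gcdn w w' = g.
    apply/eqP; rewrite -(eqn_pmul2l d0) -{1}e divnK ?dvdn_gcdl //; apply/eqP; exact: wE.
  exists (w' %/ g); first by rewrite mulnC divnK // -gE dvdn_gcdr.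
  split=> //; first by rewrite divn_gt0 // -gE dvdn_leq // dvdn_gcdr.
  by rewrite ltn_divLR // -wE.
pose A := [seq w' %/ g | w' <- F].
have -> : count (fun x => w %/ gcdn w x == d) G1 = size A by rewrite size_map size_filter.
have AP a : a \in A -> [/\ 0 < a, a < d & g * a \in G].
  by move=> /mapP [w' /FP [a' w'E [h1 h2 h3]] ->]; rewrite {1 2 3}w'E mulKn // -w'E.
apply: size_small_gcd => //.
- rewrite map_inj_in_uniq ?filter_uniq // => x x' /FP [a -> _] /FP [a' -> _].
  by rewrite !mulKn // => ->.
- by move=> a /AP [-> h _]; rewrite /= ltnW // (leq_trans h).
suff : {in A &, forall a a', a' < a -> gcdn a a' <= 2 * T}.
  move=> h a a' aA aA' /eqP; rewrite neq_ltn => /orP [] lt; last exact: h.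
  by rewrite gcdnC; exact: h.
move=> a a' /AP [a0 ad aG] /AP [a0' ad' aG'] lt.
have := gcdn_good_le aG aG' _; rewrite ltn_pmul2l // -muln_gcdr => /(_ lt).
rewrite mulnCA [T * _]mulnCA leq_pmul2l // => h.
rewrite -(leq_pmul2l n0) (leq_trans h) // (_ : n * (2 * T) = T * (2 * n)); last by ring.
by rewrite leq_mul // ltnW // (leq_trans ad).
Qed.
End Type1.

(** Everything is compared with the largest speed [w]; the others are split by whether
    [w / gcdn w w'] is at most [2 n], and [D] counts the distinct values in that case. *)
Lemma core_bounds y : 0 < size G -> 32 * (8 * T).+1 <= n -> 2 * n < y * y ->
  exists2 D : nat,
   (forall (R : realType) K, 2 <= K -> K <= D ->
     (K%:R <= 320 * T%:R * ln (K%:R : R))%R) &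
   size G <= 1 + 2 ^ 18 * (8 * T).+1 ^ 4 + D *
  ((2 * T).+1 * y + (2 * T).+1 + \sum_(1 <= s < (2 * T).+1)
     count (fun p => prime p && (y <= p)) (iota 1 (2 * n %/ s))).
Proof.
move=> sG Tn ny.
pose w := \max_(x <- G) x.
have wmax x : x \in G -> x <= w by move=> xG; rewrite /w (big_rem x) //= leq_maxl.
have wG : w \in G.
  have : has predT G by case: (G) sG.
  rewrite /w; elim: (G) => // x s IH _; rewrite big_cons inE.
  case: s IH => [|z s] IH; first by rewrite big_nil maxn0 eqxx.
  by rewrite /maxn; case: ifP => _; rewrite ?eqxx // IH ?orbT.
have w0 := G0 wG.
pose P w' := w %/ gcdn w w' <= 2 * n.
pose G1 := [seq w' <- G | (w' < w) && P w'].
pose G2 := [seq w' <- G | (w' < w) && ~~ P w'].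
have G1P : {in G1, forall w', [/\ w' \in G, w' < w & w %/ gcdn w w' <= 2 * n]}.
  by move=> w'; rewrite mem_filter => /andP [/andP []].
have uG1 : uniq G1 by rewrite filter_uniq.
exists (size (undup [seq w %/ gcdn w w' | w' <- G1])).
  by move=> R K; apply: type1_denominators.
have s1 := type1_size wG uG1 G1P ny.
have s2 : size G2 <= 2 ^ 18 * (8 * T).+1 ^ 4.
  have -> : 2 ^ 18 * (8 * T).+1 ^ 4 = (8 * T).+1 * (2 ^ 18 * (8 * T).+1 ^ 3).
    by rewrite [_ ^ 4]expnS mulnCA.
  apply: (@size_far_mult_le n w T) => //; first by rewrite filter_uniq.
    by move=> w'; rewrite mem_filter -ltnNge => /andP [/andP []].
  apply: leq_trans (GT wG); rewrite leq_mul //; apply: sub_count => b /hasP [w'].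
  rewrite mem_filter => /andP [/andP [h1 h2] h3] h4; apply/hasP; exists w' => //.
  by rewrite mem_filter h1.
have sE : size G = 1 + size G1 + size G2.
  rewrite -(count_predC (pred1 w) G) count_uniq_mem // wG -addnA; congr (_ + _).
  rewrite !size_filter; move: wmax; elim: (G) => //= x s IH h.
  rewrite IH => [|z zs]; last by apply: h; rewrite inE zs orbT.
  have := h x (mem_head _ _); rewrite leq_eqVlt.
  by case: (eqVneq x w) => [->|_] /=; [rewrite ltnn | move=> ->; case: (P x) => /=; lia].
by rewrite sE -addnA [X in _ + X]addnC addnA leq_add.
Qed.
End Core.

(** * Sampling the circle *)

Lemma count_periodic (P : pred nat) q w :
  count (fun a => P (a %% q)) (iota 0 (w * q)) = w * count P (iota 0 q).
Proof.
elim: w => [|w IH]; first by rewrite !mul0n.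
rewrite !mulSn addnC iotaD count_cat IH addnC; congr (_ + _).
rewrite add0n -[w * q]addn0 iotaDl count_map; apply: eq_in_count => r.
by rewrite mem_iota /= add0n modnMDl => rq; rewrite modn_small.
Qed.

Lemma count_near_ends_le q k : 0 < k ->
  count (fun r => (r < k) || (q < r + k)) (iota 0 q) <= 2 * k - 1.
Proof.
move=> k0; apply: (@leq_trans (size (iota 0 k ++ iota (q.+1 - k) (k - 1)))); last first.
  by rewrite size_cat !size_iota; lia.
rewrite -size_filter; apply: uniq_leq_size; first by rewrite filter_uniq ?iota_uniq.
by move=> r; rewrite mem_filter mem_cat !mem_iota; lia.
Qed.

Section Sampling.
Local Open Scope ring_scope.
Variables (R : realType) (delta : R) (n : nat) (W : seq nat) (Q : nat).
Hypotheses (n0 : (0 < n)%N) (uW : uniq W) (W0 : {in W, forall w, 0 < w}%N).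
Hypotheses (Q0 : (0 < Q)%N) (WQ : {in W, forall w, w %| Q}%N).
Hypotheses (delta_ge : 1 / (2 * n%:R) <= delta) (delta_lt : delta < 1).

Definition close w a := dist_int (a%:R / Q%:R * w%:R : R) <= delta.
Definition cover_mult a := count (close^~ a) W.
Definition overlap w := count (fun a => close w a && (2 <= cover_mult a)%N) (iota 0 Q).

Let delta_gt0 : 0 < delta.
Proof. by apply: lt_le_trans delta_ge; rewrite divr_gt0 // mulr_gt0 ?ltr0n. Qed.

(** The number of samples in a closed half of a component of [B_w], its centre included: consecutive
    samples move [t w] by [w / Q]. *)
Let k w : nat := (Num.truncn (delta * (Q %/ w)%:R)).+1.

Let QE w : w \in W -> Q = (w * (Q %/ w))%N.
Proof. by move=> wW; rewrite mulnC divnK // WQ. Qed.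

Let q0 w : w \in W -> (0 < Q %/ w)%N.
Proof. by move=> wW; rewrite divn_gt0 ?W0 // dvdn_leq // WQ. Qed.

Let dq0 w : w \in W -> 0 <= delta * (Q %/ w)%:R.
Proof. by move=> wW; rewrite mulr_ge0 ?ler0n // ltW. Qed.

Let k_gt w : w \in W -> delta * (Q %/ w)%:R < (k w)%:R.
Proof. by move=> wW; have /andP [] := truncn_itv (dq0 wW). Qed.

Let k_le w r : w \in W -> (r < k w)%N -> r%:R <= delta * (Q %/ w)%:R.
Proof.
move=> wW rk; have /andP [h _] := truncn_itv (dq0 wW).
by apply: le_trans h; rewrite ler_nat.
Qed.

Let sampleE w a : w \in W -> a%:R / Q%:R * w%:R = a%:R / (Q %/ w)%:R :> R.
Proof.
move=> wW; rewrite {1}(QE wW) natrM.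
have w0 : w%:R != 0 :> R by rewrite pnatr_eq0 -lt0n W0.
have q0' : (Q %/ w)%:R != 0 :> R by rewrite pnatr_eq0 -lt0n q0.
by field; rewrite w0 q0'.
Qed.

Lemma close_mod w a : w \in W -> close w a ->
  ((a %% (Q %/ w) < k w) || (Q %/ w < a %% (Q %/ w) + k w))%N.
Proof.
move=> wW; rewrite /close sampleE //; set q := (Q %/ w)%N => h.
have q0' : 0 < q%:R :> R by rewrite ltr0n q0.
apply: contraLR h; rewrite negb_or -!leqNgt -ltNge => /andP [h1 h2].
apply: (@lt_le_trans _ _ ((k w)%:R / q%:R)); first by rewrite ltr_pdivlMr // k_gt.
apply: dist_int_ge => m.
rewrite {1}(divn_eq a q) natrD natrM mulrDl mulfK ?lt0r_neq0 //.
set f := (a %/ q)%N; set r := (a %% q)%N in h1 h2 *.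
have [mf|mf] := leP m (f%:Z).
  have mf' : m%:~R <= f%:R :> R by rewrite -[f%:R]/((f%:Z)%:~R) ler_int.
  apply: le_trans (ler_norm _); rewrite addrAC.
  apply: le_trans (_ : r%:R / q%:R <= _); last by rewrite lerDr subr_ge0.
  by rewrite ler_pM2r ?invr_gt0 // ler_nat.
have mf' : f%:R + 1 <= m%:~R :> R.
  have -> : f%:R + 1 = (f%:Z + 1)%:~R :> R by rewrite intrD.
  by rewrite ler_int lezD1.
rewrite distrC; apply: le_trans (ler_norm _).
have : (k w)%:R / q%:R + r%:R / q%:R <= 1 :> R.
  by rewrite -mulrDl ler_pdivrMr // mul1r -natrD ler_nat addnC.
rewrite lerBrDr addrCA => h; apply: le_trans mf'; exact: lerD.
Qed.

(** Each of the [w] components contains at most [2 k - 1 <= 2 delta Q / w + 1] samples; the rounding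
    error [w] is negligible for large [Q]. *)
Lemma count_close_le w : w \in W ->
  (count (close w) (iota 0 Q))%:R <= 2 * delta * Q%:R + w%:R.
Proof.
move=> wW; set q := (Q %/ w)%N.
have h1 : (count (close w) (iota 0 Q) <= w * (2 * k w - 1))%N.
  apply: (@leq_trans (count (fun a => (a %% q < k w) || (q < a %% q + k w))%N (iota 0 Q))).
    by apply: sub_count => a; exact: close_mod.
  rewrite (QE wW) -/q (count_periodic (fun r => (r < k w) || (q < r + k w))%N) leq_mul //.
  exact: count_near_ends_le.
apply: (@le_trans _ _ (w * (2 * k w - 1))%:R); first by rewrite ler_nat.
have -> : (2 * k w - 1 = 2 * (k w).-1 + 1)%N by rewrite /k; move: (Num.truncn _); clear; lia.
have h2 : (k w).-1%:R <= delta * q%:R by apply: k_le.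
rewrite natrM natrD natrM [Q in leRHS](QE wW) -/q natrM.
rewrite mulrDr mulr1 lerD2r.
rewrite (_ : 2 * delta * (w%:R * q%:R) = w%:R * (2 * (delta * q%:R))); last by ring.
by rewrite !ler_wpM2l.
Qed.

(** Pointwise in [a]: a multiplicity [m >= 1] satisfies [m [m >= 2] + 2 <= 2 m]. *)
Lemma sum_overlap_le : (forall a, (1 <= cover_mult a)%N) ->
  (\sum_(w <- W) overlap w + 2 * Q <= 2 * \sum_(w <- W) count (close w) (iota 0 Q))%N.
Proof.
move=> cov.
have E (P : pred nat) : count P (iota 0 Q) = (\sum_(a <- iota 0 Q) P a)%N.
  by elim: (iota 0 Q) => [|a s IH]; rewrite ?big_nil // big_cons /= IH.
have mE a : cover_mult a = (\sum_(w <- W) close w a)%N.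
  by rewrite /cover_mult; elim: W => [|w s IH]; rewrite ?big_nil // big_cons /= IH.
under eq_bigr => w _ do rewrite /overlap E.
under [X in (_ <= 2 * X)%N]eq_bigr => w _ do rewrite E.
rewrite exchange_big /= [X in (_ <= 2 * X)%N]exchange_big /=.
rewrite -{2}(size_iota 0 Q); elim: (iota 0 Q) => [|a s IH]; first by rewrite !big_nil.
rewrite !big_cons /= -mE.
have -> : (\sum_(j <- W) (close j a && (2 <= cover_mult a)) = cover_mult a * (2 <= cover_mult a))%N.
  case: (2 <= cover_mult a)%N; last by rewrite muln0 big1 // => w _; rewrite andbF.
  by rewrite muln1 mE; apply: eq_bigr => w _; rewrite andbT.
have := cov a; case: ltnP; move: IH; move: (\sum_(_ <- s) _)%N (\sum_(_ <- s) _)%N (cover_mult a) => x y z; clear; lia.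
Qed.

(* [(w - b) %% w] stands for [- b], so that [b w' / w] lies just above an
   integer, the sample [a / Q] is at distance [r / Q] to the right of [- b / w],
   and the two deviations of [a w' / Q] from an integer have opposite signs. *)
Lemma near_smaller_overlap w : w \in W ->
  (count (near_smaller n W w) (iota 0 w))%:R * (delta * (Q %/ w)%:R) <= (overlap w)%:R.
Proof.
move=> wW; set q := (Q %/ w)%N; have w0 := W0 wW.
have qp : 0 < q%:R :> R by rewrite ltr0n q0.
have wp : 0 < w%:R :> R by rewrite ltr0n.
suff h : (count (near_smaller n W w) (iota 0 w) * k w <= overlap w)%N.
  apply: (@le_trans _ _ ((count (near_smaller n W w) (iota 0 w)) * k w)%:R).
    by rewrite natrM ler_wpM2l // ltW // k_gt.
  by rewrite ler_nat.
have kq r : (r < k w)%N -> (r < q)%N.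
  move=> /(k_le wW) h; rewrite -(ltr_nat R); apply: le_lt_trans h _.
  by rewrite -/q -{2}[q%:R]mul1r ltr_pM2r.
have kd r : (r < k w)%N -> r%:R <= delta * q%:R := k_le wW.
move: (k w) kq kd => K kq kd.
pose f b r := ((w - b) %% w * q + r)%N.
rewrite -size_filter -(size_iota 0 K) -(size_allpairs f) /overlap -size_filter.
apply: uniq_leq_size.
  apply: allpairs_uniq; rewrite ?filter_uniq ?iota_uniq //.
  move=> [b r] [b' r'] /allpairsP [[? ?]] /= [h1 h2 [bE rE]].
  move=> /allpairsP [[? ?]] /= [h1' h2' [bE' rE']] e.
  move: h1 h2 h1' h2'; rewrite -bE -rE -bE' -rE' !mem_filter !mem_iota !add0n.
  move=> /andP [_ bw] /kq rq /andP [_ bw'] /kq rq'.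
  have e1 : ((w - b) %% w = (w - b') %% w)%N.
    by move/(congr1 (divn^~ q)): e; rewrite /= /f !divnMDl ?q0 // !divn_small // !addn0.
  have er : r = r' by move: e; rewrite /f e1 => /addnI.
  rewrite er; congr (_, _); move: bw bw' => /= bw bw'.
  have small c : (c < w)%N -> ((w - c) %% w = if c == 0 then 0 else w - c)%N.
    move=> cw; case: eqVneq => [->|c0]; first by rewrite subn0 modnn.
    by rewrite modn_small //; lia.
  move: e1; rewrite !small //; move: bw bw'; clear => bw bw'.
  by case: (eqVneq b 0%N) => [->|b0]; case: (eqVneq b' 0%N) => [->|b0']; lia.
move=> a /allpairsP [[b r]] /= [].
rewrite mem_filter !mem_iota add0n => /andP [Ub bw] rk ->.
have rq := kq _ rk; have rd := kd _ rk.
set b' := ((w - b) %% w)%N.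
have b'w : (b' < w)%N by rewrite ltn_mod.
have aQ : (f b r < Q)%N.
  rewrite (QE wW) -/q; apply: (@leq_trans (b'.+1 * q)).
    by rewrite /f mulSn addnC ltn_add2r.
  by rewrite leq_mul2r b'w orbT.
rewrite mem_filter mem_iota add0n aQ !andbT.
case/hasP: Ub => w'; rewrite mem_filter => /andP [w'w w'W] near.
have w'0 := W0 w'W.
have cw : close w (f b r).
  rewrite /close sampleE // -/q /f natrD natrM mulrDl mulfK ?lt0r_neq0 //.
  apply: le_trans (dist_int_le _ b'%:Z) _.
  rewrite -[b'%:Z%:~R]/(b'%:R) addrAC subrr add0r ger0_norm ?divr_ge0 //.
  by rewrite ler_pdivrMr.
have cw' : close w' (f b r).
  rewrite /close.
  have -> : (f b r)%:R / Q%:R * w'%:R =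
      (b' * w')%:R / w%:R + r%:R / q%:R * (w'%:R / w%:R) :> R.
    rewrite {1}(QE wW) -/q /f natrD !natrM -/b'.
    by field; rewrite !lt0r_neq0.
  set rho := ((b * w') %% w)%N in near *.
  have [z zE] : exists z : int, (b' * w')%:Z = z * w%:Z - rho%:Z.
    have e1 : ((w - b) %/ w * w + b' = w - b)%N by rewrite -divn_eq.
    have e2 : ((b * w') %/ w * w + rho = b * w')%N by rewrite -divn_eq.
    exists (w'%:Z - ((w - b) %/ w)%:Z * w'%:Z - ((b * w') %/ w)%:Z).
    move: ((w - b) %/ w)%N e1 ((b * w') %/ w)%N e2 => c1 e1 c2 e2.
    have E1 : b'%:Z = w%:Z - b%:Z - c1%:Z * w%:Z by move: bw e1; clear; lia.
    have E2 : rho%:Z = b%:Z * w'%:Z - c2%:Z * w%:Z by rewrite -PoszM -e2; clear; lia.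
    rewrite PoszM E1 E2; ring.
  apply: le_trans (dist_int_le _ z) _.
  have -> : (b' * w')%:R = z%:~R * w%:R - rho%:R :> R.
    by rewrite -[(b' * w')%:R]/((b' * w')%:Z%:~R) zE intrB intrM.
  have -> : (z%:~R * w%:R - rho%:R) / w%:R + r%:R / q%:R * (w'%:R / w%:R) - z%:~R =
      r%:R / q%:R * (w'%:R / w%:R) - rho%:R / w%:R :> R by field; rewrite !lt0r_neq0.
  have x0 : 0 <= rho%:R / w%:R :> R by rewrite divr_ge0.
  have x1 : rho%:R / w%:R <= delta.
    apply: le_trans delta_ge; rewrite ler_pdivrMr // mulrC mulrA mulr1.
    rewrite ler_pdivlMr ?mulr_gt0 ?ltr0n // -!natrM ler_nat mulnC.
    by move: near; rewrite /near_mult; exact: ltnW.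
  have y0 : 0 <= r%:R / q%:R * (w'%:R / w%:R) :> R by rewrite mulr_ge0 // divr_ge0.
  have y1 : r%:R / q%:R * (w'%:R / w%:R) <= delta.
    apply: (@le_trans _ _ (r%:R / q%:R)).
      by rewrite ler_piMr ?divr_ge0 // ler_pdivrMr // mul1r ler_nat ltnW.
    by rewrite ler_pdivrMr.
  by rewrite ler_norml; apply/andP; split; move: x0 x1 y0 y1; lra.
rewrite cw /= /cover_mult -size_filter.
apply: (@uniq_leq_size _ [:: w; w']).
  by rewrite /= inE andbT; apply/eqP => e; move: w'w; rewrite e ltnn.
by move=> x; rewrite !inE mem_filter => /orP [] /eqP ->; rewrite ?cw ?cw' ?wW ?w'W.
Qed.

End Sampling.

Local Open Scope ring_scope.

(** The covering has total overlap at most [4 ov Q] samples, and a bad speed accounts for at least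
    [T Q / (2 n ^ 2)] of them. As [T >= 64 n ov], at most [n / 8] speeds are bad, out of at least
    [n / 2]. *)
Lemma good_speeds (R : realType) (delta : R) n T (W : seq nat) :
  (0 < n)%N -> uniq W -> {in W, forall w, 0 < w}%N -> (size W <= n)%N ->
  1 / (2 * n%:R) < delta -> 2 * n%:R * delta <= 5 / 4 ->
  64 * n%:R * (2 * n%:R * delta - 1) <= T%:R ->
  (forall t : R, exists2 w, w \in W & dist_int (t * w%:R) <= delta) ->
  exists G : seq nat, [/\ uniq G, {in G, forall w, 0 < w}%N, (n <= 4 * size G)%N &
    {in G, forall w, n * count (near_smaller n G w) (iota 0 w) <= T * w}%N].
Proof.
move=> n0 uW W0 sW dgt dle TT cov.
have np : 0 < n%:R :> R by rewrite ltr0n.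
set ov := 2 * n%:R * delta - 1 in TT.
have ov0 : 0 < ov.
  by rewrite subr_gt0; move: dgt; rewrite ltr_pdivrMr ?mulr_gt0 // mulrC.
pose S := (\sum_(w <- W) w)%N.
(* Makes [Q] large enough for the rounding errors, of total [S], to be at most [ov * Q]. *)
pose M := (Num.truncn (S%:R / ov)).+1.
pose Q := (M * \prod_(w <- W) w)%N.
have P0 : (0 < \prod_(w <- W) w)%N by rewrite big_seq; apply: prodn_cond_gt0.
have Q0 : (0 < Q)%N by rewrite muln_gt0.
have Qp : 0 < Q%:R :> R by rewrite ltr0n.
have WQ : {in W, forall w, w %| Q}%N.
  by move=> w wW; rewrite /Q dvdn_mull // (big_rem w) //= dvdn_mulr.
have SQ : S%:R <= ov * Q%:R.
  rewrite mulrC -ler_pdivrMr //; apply: (@le_trans _ _ M%:R).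
    by rewrite ltW //; have /andP [] := truncn_itv (divr_ge0 (ler0n R S) (ltW ov0)).
  by rewrite ler_nat /Q leq_pmulr.
have dge : 1 / (2 * n%:R) <= delta by exact: ltW.
have dlt : delta < 1.
  have n1 : 1 <= n%:R :> R by rewrite ler1n.
  rewrite ltNge; apply/negP => d1.
  have : 1 <= n%:R * delta by exact: mulr_ege1.
  by move: dle; rewrite -mulrA; clear; lra.
have cov' a : (1 <= cover_mult delta W Q a)%N.
  by have [w wW h] := cov (a%:R / Q%:R); rewrite -has_count; apply/hasP; exists w.
have h1 := sum_overlap_le cov'.
have h2 : (\sum_(w <- W) count (close delta Q w) (iota 0 Q))%:R <=
    (2 * delta * (size W)%:R + ov) * Q%:R.
  rewrite natr_sum mulrDl; apply: (@le_trans _ _ (2 * delta * (size W)%:R * Q%:R + S%:R)); last first.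
    by rewrite lerD2l.
  have -> : 2 * delta * (size W)%:R * Q%:R + S%:R =
      \sum_(w <- W) (2 * delta * Q%:R + w%:R) :> R.
    rewrite big_split /= big_const_seq count_predT iter_addr_0 /S natr_sum; congr (_ + _).
    by rewrite -[RHS]mulr_natr mulrAC.
  rewrite !big_seq; apply: ler_sum => w wW.
  exact: (count_close_le _ _ _ _ dge wW).
have d0 : 0 < delta by apply: lt_trans dgt; rewrite divr_gt0 ?mulr_gt0.
(* The covering itself forces [|W| >= n / 2], because [2 n delta <= 5 / 4] and [ov <= 1 / 4]. *)
have sWge : n%:R <= 2 * (size W)%:R :> R.
  have : Q%:R <= (2 * delta * (size W)%:R + ov) * Q%:R.
    by apply: le_trans h2; rewrite ler_nat -(leq_pmul2l (isT : 0 < 2)%N) (leq_trans _ h1) ?leq_addl.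
  rewrite -{1}[Q%:R]mul1r ler_pM2r // => h3.
  have h4 : 2 * n%:R * delta * (size W)%:R <= 5 / 4 * (size W)%:R by rewrite ler_wpM2r.
  have h5 : n%:R * 1 <= n%:R * (2 * delta * (size W)%:R + ov) by rewrite ler_wpM2l // ltW.
  have h6 : n%:R * ov <= n%:R * (1 / 4) by rewrite ler_wpM2l ?(ltW np) // /ov; lra.
  have := ler0n R (size W); move: h4 h5 h6; move: ((size W)%:R) (n%:R) (delta) (ov) => a b c d; clear; nra.
have h3 : (\sum_(w <- W) overlap delta W Q w)%:R <= 4 * ov * Q%:R.
  have : (\sum_(w <- W) overlap delta W Q w)%:R + 2 * Q%:R <=
    2 * (\sum_(w <- W) count (close delta Q w) (iota 0 Q))%:R :> R.
    by rewrite -!natrM -natrD ler_nat.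
  have : 2 * delta * (size W)%:R * Q%:R <= (1 + ov) * Q%:R.
    rewrite ler_wpM2r // /ov addrC subrK -mulrA [2 * n%:R * _]mulrAC -mulrA.
    by rewrite ler_wpM2l // ler_wpM2l ?ler_nat // ltW.
  move: h2; move: (\sum_(w <- W) overlap _ _ _ _)%:R (\sum_(w <- W) count _ _)%:R => a b.
  move: (delta) (ov) (Q%:R) (size W)%:R => c d e f; clear; lra.
pose good w := (n * count (near_smaller n W w) (iota 0 w) <= T * w)%N.
exists [seq w <- W | good w]; split.
- by rewrite filter_uniq.
- by move=> w; rewrite mem_filter => /andP [_ /W0].
- have Tp : 0 < T%:R :> R by apply: lt_le_trans TT; rewrite !mulr_gt0.
  have bad : 8 * (count (predC good) W)%:R <= n%:R :> R.
    have hb w : w \in W -> ~~ good w ->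
        T%:R * Q%:R / (2 * n%:R) <= n%:R * (overlap delta W Q w)%:R :> R.
      move=> wW; rewrite -ltnNge => /ltnW bw.
      have wp : 0 < w%:R :> R by rewrite ltr0n W0.
      have := near_smaller_overlap n0 uW W0 Q0 WQ dge dlt wW.
      rewrite -(ler_pM2l np) => h; apply: le_trans h.
      rewrite [leRHS]mulrA; apply: (@le_trans _ _ (T%:R * w%:R * (delta * (Q %/ w)%:R))); last first.
        by rewrite ler_wpM2r ?mulr_ge0 ?(ltW d0) // -!natrM ler_nat.
      have -> : T%:R * w%:R * (delta * (Q %/ w)%:R) = T%:R * Q%:R * delta.
        have QE : Q%:R = w%:R * (Q %/ w)%:R :> R by rewrite -natrM mulnC divnK ?WQ.
        by rewrite QE; ring.
      by rewrite ler_wpM2l ?mulr_ge0 // -[leLHS]mul1r.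
    have h4 : (count (predC good) W)%:R * (T%:R * Q%:R / (2 * n%:R)) <=
        n%:R * (\sum_(w <- W) overlap delta W Q w)%:R :> R.
      rewrite natr_sum (bigID good) /= mulrDr -[leLHS]add0r lerD //.
        by rewrite mulr_ge0 // ?sumr_ge0 // ltW.
      rewrite mulr_sumr mulr_natl -iter_addr_0 -big_const_seq /=.
      by rewrite big_seq_cond [leRHS]big_seq_cond; apply: ler_sum => w /andP [wW bw]; exact: hb.
    have h5 : (count (predC good) W)%:R * (T%:R * Q%:R / (2 * n%:R)) <=
       n%:R * (4 * ov * Q%:R) by apply: le_trans h4 _; rewrite ler_wpM2l // ltW.
    have TQ : 0 < T%:R * Q%:R / (2 * n%:R) :> R by rewrite divr_gt0 ?mulr_gt0.
    rewrite -(ler_pM2r TQ) -[leLHS]mulrA.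
    apply: (@le_trans _ _ (8 * (n%:R * (4 * ov * Q%:R)))); first by rewrite ler_wpM2l.
    have -> : n%:R * (T%:R * Q%:R / (2 * n%:R)) = T%:R * Q%:R / 2 :> R.
      by field; rewrite lt0r_neq0.
    rewrite (_ : 8 * _ = 64 * n%:R * ov * (Q%:R / 2)); last by field.
    by rewrite -[leRHS]mulrA ler_wpM2r ?divr_ge0.
  rewrite size_filter -(ler_nat R) natrM.
  have : (size W)%:R = (count good W)%:R + (count (predC good) W)%:R :> R.
    by rewrite -natrD count_predC.
  move: sWge bad (ler0n R n); move: (size W)%:R (count good W)%:R (count _ W)%:R (n%:R) => a b c d; clear.
  by lra.
(* Goodness is inherited by a subset, since [near_smaller] is monotone in the set of speeds. *)
move=> w; rewrite mem_filter => /andP [gw wW]; apply: leq_trans gw.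
rewrite leq_mul //; apply: sub_count => b /hasP [w' h nb]; apply/hasP; exists w' => //.
by move: h; rewrite !mem_filter => /and3P [-> _ ->].
Qed.

(** * Numerical estimates for large n *)

Section Asymptotics.
Variables (R : realType) (n : nat).
Let lam : R := ln n%:R.
Let mu : R := ln lam.
Hypothesis mu_large : 10 ^+ 7 <= mu.

Lemma lam_gt0 : 0 < lam.
Proof.
rewrite ltNge; apply/negP => /ln0 e; move: mu_large; rewrite /mu e.
by rewrite leNgt exprn_gt0.
Qed.

Lemma n_gt0 : (0 < n)%N.
Proof.
rewrite lt0n; apply/negP => /eqP e; have := lam_gt0.
by rewrite /lam e ln0 ?ltxx.
Qed.

Let np : 0 < n%:R :> R. Proof. by rewrite ltr0n n_gt0. Qed.

(** Here and below, lower bounds [x ^ k / k!] for the exponential stand in for limits. *)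
Lemma mu_lam : mu ^+ 3 / 6 <= lam.
Proof.
rewrite -[leRHS]lnK ?posrE ?lam_gt0 // -/mu.
have mu0 : 0 <= mu by apply: le_trans mu_large; rewrite exprn_ge0.
have := expR_ge1Dxn 2 mu0; apply: le_trans.
by rewrite (_ : (3`!)%:R = 6) // lerDr.
Qed.

Lemma lam_ge : 10 ^+ 14 <= lam.
Proof.
apply: le_trans mu_lam; rewrite ler_pdivlMr //.
have h : (10 ^+ 7) ^+ 3 <= mu ^+ 3.
  by rewrite lerXn2r ?nnegrE ?exprn_ge0 // (le_trans _ mu_large) ?exprn_ge0.
apply: le_trans h; rewrite -exprM -[X in _ <= 10 ^+ X]/(14 + 7)%N exprD ler_wpM2l ?exprn_ge0 //.
by lra.
Qed.

Lemma lam_mu2 : (2 ^+ 9 * 10 ^+ 3) * mu ^+ 2 <= lam.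
Proof.
apply: le_trans mu_lam; rewrite ler_pdivlMr // [mu ^+ 3]exprS.
rewrite mulrAC ler_wpM2r ?sqr_ge0 //; apply: le_trans mu_large.
by lra.
Qed.

Lemma lam_n6 : lam ^+ 6 / 720 <= n%:R.
Proof.
rewrite -[leRHS]lnK ?posrE // -/lam.
have := expR_ge1Dxn 5 (ltW lam_gt0); apply: le_trans.
by rewrite (_ : (6`!)%:R = 720) // lerDr.
Qed.

Let E : R := expR (lam / 2).

Lemma E_sqr : E * E = n%:R.
Proof. by rewrite /E -expRD -splitr lnK ?posrE. Qed.

Lemma E_ge : lam ^+ 3 / 48 <= E.
Proof.
have l2 : 0 <= lam / 2 by rewrite divr_ge0 // ltW // lam_gt0.
have := expR_ge1Dxn 2 l2; apply: le_trans.
rewrite (_ : (3`!)%:R = 6) //; move: (lam) => x; lra.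
Qed.

Variables (T D y : nat).
Hypothesis yE : y = (Num.truncn (2 * E)).+1.
Hypothesis T1 : (0 < T)%N.
Hypothesis TL : T%:R <= lam / mu ^+ 2 / (2 ^+ 8 * 10 ^+ 3) + 1.

Let E0 : 0 < E. Proof. exact: expR_gt0. Qed.

Let mu1 : 1 <= mu.
Proof. by apply: le_trans mu_large; rewrite -natrX ler1n. Qed.

Let y_bounds : 2 * E < y%:R <= 2 * E + 1.
Proof.
have /andP [h1 h2] := truncn_itv (mulr_ge0 (ler0n R 2) (ltW E0)).
by rewrite yE h2 /= -natr1 lerD2r.
Qed.

Lemma y_sqr_gt : (2 * n < y * y)%N.
Proof.
rewrite -(ltr_nat R) !natrM -E_sqr; have /andP [h _] := y_bounds.
have : (2 * E) * (2 * E) < y%:R * y%:R by rewrite ltr_pM ?mulr_ge0 // ltW.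
by have := mulr_gt0 E0 E0; move: (E) (y%:R) => a b; lra.
Qed.

Lemma ln_y_ge : lam / 2 <= ln y%:R.
Proof.
have /andP [h _] := y_bounds.
have yp : 0 < y%:R :> R by rewrite yE ltr0n.
rewrite -[leLHS]expRK ler_ln ?posrE //; apply: le_trans (ltW h).
by rewrite ler_peMl ?ltW // ltr1n.
Qed.

Lemma T_le : T%:R <= lam / 2 ^+ 8.
Proof.
apply: le_trans TL _.
have h : lam / mu ^+ 2 <= lam.
  rewrite ler_pdivrMr ?exprn_gt0 ?(lt_le_trans ltr01) // ler_peMr ?(ltW lam_gt0) //.
  by rewrite exprn_ege1.
have h1 := lam_ge.
by move: h h1; move: (lam / mu ^+ 2) (lam) => x l; lra.
Qed.

(** Chebyshev's bound with [ln y >= lam / 2] and [ln 4 <= 3] gives at most [12 n / (lam s)] primes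
    for each [s]; the harmonic sum up to [2 T <= lam] is at most [1 + mu <= 2 mu]. *)
Lemma sum_count_primes_le :
  (\sum_(1 <= s < (2 * T).+1) count (fun p => prime p && (y <= p)%N)
     (iota 1 (2 * n %/ s)))%:R <= 24 * (n%:R * mu / lam).
Proof.
have l0 := lam_gt0.
have T0 : 0 < T%:R :> R by rewrite ltr0n.
have h (s : nat) : (0 < s)%N ->
    (count (fun p => prime p && (y <= p)%N) (iota 1 (2 * n %/ s)))%:R <=
    12 * n%:R / lam * s%:R^-1.
  move=> s0; have sp : 0 < s%:R :> R by rewrite ltr0n.
  set cnt := count _ _.
  have yp : 0 < y%:R :> R by rewrite yE ltr0n.
  have h1 : ln (y%:R : R) *+ cnt <= ln 4 *+ (2 * n %/ s).
    rewrite -!lnXn // ler_ln ?posrE ?exprn_gt0 // -!natrX ler_nat.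
    exact: count_primes_le.
  have h2 : cnt%:R * (lam / 2) <= cnt%:R * ln y%:R by rewrite ler_wpM2l // ln_y_ge.
  have ln4 : ln 4 <= 3 :> R by have := @le_ln1Dx R 3; rewrite (_ : 1 + 3 = 4); lra.
  have h3 : (2 * n %/ s)%:R * ln 4 <= (2 * n %/ s)%:R * 3 :> R by rewrite ler_wpM2l.
  have h4 : (2 * n %/ s)%:R <= 2 * n%:R / s%:R :> R.
    by rewrite ler_pdivlMr // -!natrM ler_nat leq_trunc_div.
  move: h1; rewrite -[ln y%:R *+ _]mulr_natl -[ln 4 *+ _]mulr_natl => h1.
  have h5 : cnt%:R * (lam / 2) <= 2 * n%:R / s%:R * 3.
    by apply: (le_trans h2); apply: (le_trans h1); apply: (le_trans h3); rewrite ler_wpM2r.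
  rewrite mulrAC ler_pdivlMr //; move: h5; move: (s%:R^-1) (n%:R) (lam) (cnt%:R) => a b c d.
  by lra.
rewrite natr_sum.
apply: (@le_trans _ _ (\sum_(1 <= s < (2 * T).+1) 12 * n%:R / lam * s%:R^-1)).
  rewrite !big_seq; apply: ler_sum => s; rewrite mem_index_iota => /andP [s0 _]; exact: h.
rewrite -mulr_sumr.
have T2 : (0 < 2 * T)%N by rewrite muln_gt0.
have hm : \sum_(1 <= m < (2 * T).+1) (m%:R)^-1 <= 2 * mu.
  apply: le_trans (harmonic_le R T2) _.
  have : ln ((2 * T)%:R : R) <= mu.
    rewrite ler_ln ?posrE ?ltr0n //.
    by have := T_le; rewrite natrM; move: (T%:R) l0 => x l0; lra.
  by move: mu1; move: (ln (2 * T)%:R) (mu) => a b; lra.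
have c0 : 0 <= 12 * n%:R / lam by rewrite divr_ge0 ?mulr_ge0 // ltW.
apply: le_trans (ler_wpM2l c0 hm) _.
by rewrite le_eqVlt; apply/orP; left; apply/eqP; field; rewrite lt0r_neq0.
Qed.

(** With [E] the square root of [n], the left side is [O(lam E)], and [lam ^ 2 <= E]. *)
Lemma small_terms_le : (2 * T).+1%:R * (y%:R + 1) <= n%:R * mu / lam.
Proof.
have l0 := lam_gt0; have lb := lam_ge; have tb := T_le.
have /andP [_ yb] := y_bounds; have eb := E_ge.
have E1 : lam ^+ 2 <= E.
  apply: le_trans eb; rewrite ler_pdivlMr // [lam ^+ 3]exprS mulrC ler_wpM2r ?sqr_ge0 //; lra.
have E2 : 1 <= E by apply: le_trans E1; rewrite exprn_ege1 //; lra.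
rewrite ler_pdivlMr //.
have t1 : (2 * T).+1%:R <= lam :> R by rewrite -natr1 natrM; lra.
apply: (@le_trans _ _ (lam / 4 * (4 * E) * lam)).
  rewrite ler_wpM2r ?(ltW l0) // ler_pM ?addr_ge0 //; last by lra.
  by rewrite -natr1 natrM; lra.
apply: (@le_trans _ _ (E * lam ^+ 2)); first by move: (lam) (E) => a b; lra.
rewrite -E_sqr -mulrA ler_wpM2l ?(ltW E0) // (le_trans E1) // ler_peMr ?(ltW E0) //.
Qed.

(** A quantity of order [lam ^ 4] against [n >= lam ^ 6 / 720]. *)
Lemma far_terms_le : 4 * (1 + 2 ^ 18 * (8 * T).+1 ^ 4)%:R <= n%:R / 2 :> R.
Proof.
have l0 := lam_gt0; have lb := lam_ge; have tb := T_le; have nb := lam_n6.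
rewrite natrD natrM !natrX.
have t1 : (8 * T).+1%:R <= lam / 16 :> R by rewrite -natr1 natrM; lra.
have t2 : (8 * T).+1%:R ^+ 4 <= (lam / 16) ^+ 4 :> R.
  by rewrite lerXn2r ?nnegrE // divr_ge0 // ltW.
have l4 : 1 <= lam ^+ 4 by rewrite exprn_ege1 //; lra.
have l2 : 10 ^+ 5 <= lam ^+ 2.
  rewrite expr2; apply: le_trans (_ : 10 ^+ 5 * 1 <= _); first by rewrite mulr1.
  by rewrite ler_pM //; lra.
have l6 : 10 ^+ 5 * lam ^+ 4 <= lam ^+ 6.
  by rewrite [lam ^+ 6](exprD lam 2 4) ler_wpM2r // exprn_ge0 // ltW.
move: t2; rewrite expr_div_n; move: (lam ^+ 4) (lam ^+ 6) ((8 * T).+1%:R ^+ 4) l4 l6 nb => a b c.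
by move=> *; lra.
Qed.

(** The size bound forces [D >= x = lam / (200 mu)]. Taking for [K] the integer part of [x] gives
    [x / 2 <= 320 T mu], that is [L <= 2 ^ 7 * 10 ^ 3 * T]; with the bound on [T] this makes
    [L <= 2 ^ 8 * 10 ^ 3], whereas [lam_mu2] says [L >= 2 ^ 9 * 10 ^ 3]. *)
Lemma asymptotic_contradiction :
  (forall K, (2 <= K)%N -> (K <= D)%N -> K%:R <= 320 * T%:R * ln (K%:R : R)) ->
  (n <= 4 * (1 + 2 ^ 18 * (8 * T).+1 ^ 4 + D *
  ((2 * T).+1 * y + (2 * T).+1 + \sum_(1 <= s < (2 * T).+1)
     count (fun p => prime p && (y <= p)) (iota 1 (2 * n %/ s)))))%N -> False.
Proof.
move=> hK; rewrite -(ler_nat R) => hn.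
have l0 := lam_gt0; have lb := lam_ge; have lm := lam_mu2.
have mu0 : 0 < mu by apply: lt_le_trans mu1.
have h1 := sum_count_primes_le; have h2 := small_terms_le; have h3 := far_terms_le.
set a := n%:R * mu / lam in h1 h2.
have a0 : 0 < a by rewrite divr_gt0 ?mulr_gt0.
(* [25 = 24 + 1] for the primes and the small terms; the far terms use up the other half of [n]. *)
have hD : n%:R / 2 <= 4 * (D%:R * (25 * a)) :> R.
  move: h1 h2 hn h3.
  set F := (1 + _)%N; set S := (\sum_(1 <= s < _) _)%N; set P := (2 * T).+1.
  clearbody F S P; rewrite (natrM _ 4) natrD (natrM _ D) !natrD natrM => h1 h2 hn h3.
  have : D%:R * (P%:R * y%:R + P%:R + S%:R) <= D%:R * (25 * a) :> R.
    by rewrite ler_wpM2l //; move: h1 h2; rewrite mulrDr mulr1; lra.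
  by move: hn h3; lra.
pose x := lam / (200 * mu).
have xD : x <= D%:R.
  rewrite ler_pdivrMr ?mulr_gt0 //.
  have e : n%:R / 2 = a * (lam / (2 * mu)) :> R.
    by rewrite /a; field; rewrite !lt0r_neq0.
  move: hD; rewrite e (_ : 4 * _ = a * (100 * D%:R)); last by ring.
  rewrite ler_pM2l // ler_pdivrMr ?mulr_gt0 //; move: (mu) (lam) (D%:R) => u v w'; lra.
have mm : mu <= mu ^+ 2 by rewrite expr2 ler_peMl ?(ltW mu0).
have x2 : 2 <= x.
  by rewrite ler_pdivlMr ?mulr_gt0 //; move: lm mm mu0; move: (mu ^+ 2) (mu) (lam) => u v w'; lra.
have x0 : 0 <= x by lra.
have /andP [kx xk] := truncn_itv x0.
set K := Num.truncn x in kx xk.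
have K2 : (2 <= K)%N by rewrite truncn_ge_nat.
have KD : (K <= D)%N by rewrite -(ler_nat R) (le_trans kx).
have Kp : 0 < K%:R :> R by rewrite ltr0n (leq_trans _ K2).
have lnK : ln (K%:R : R) <= mu.
  rewrite ler_ln ?posrE //; apply: le_trans kx _; rewrite ler_pdivrMr ?mulr_gt0 //.
  by rewrite ler_peMr ?(ltW l0) //; move: mu1; lra.
have h4 : x / 2 <= 320 * T%:R * mu.
  apply: (@le_trans _ _ K%:R); first by move: xk; rewrite -natr1; lra.
  by apply: le_trans (hK _ K2 KD) _; rewrite ler_wpM2l ?mulr_ge0.
pose L := lam / mu ^+ 2.
have L1 : L <= 2 ^+ 7 * 10 ^+ 3 * T%:R.
  rewrite ler_pdivrMr ?exprn_gt0 //.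
  have e : x / 2 * (400 * mu) = lam by rewrite /x; field; rewrite lt0r_neq0.
  rewrite -e; apply: le_trans (ler_wpM2r _ h4) _; first by rewrite mulr_ge0 ?ltW.
  by move: (T%:R) (mu) => u v; lra.
have L2 : 2 ^+ 9 * 10 ^+ 3 <= L by rewrite ler_pdivlMr ?exprn_gt0.
by move: TL; rewrite -/L; move: L1 L2; move: (T%:R) (L) => u v; lra.
Qed.
End Asymptotics.

(** * Reduction to a covering of the circle *)

Lemma dist_int_opp (R : realType) (t : R) : dist_int (- t) = dist_int t.
Proof.
suff h s : dist_int (- s) <= dist_int s :> R.
  by apply/eqP; rewrite eq_le h /= -{1}[t]opprK h.
apply: dist_int_ge => m; apply: le_trans (dist_int_le _ (- m)) _.
by rewrite intrN -opprD normrN.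
Qed.

Lemma min_dist_lt (R : realType) (v : seq int) (t d : R) : d <= 2^-1 ->
  min_dist v t < d -> exists2 w, w \in v & dist_int (t * w%:~R) < d.
Proof.
move=> d2; rewrite /min_dist; elim: v => [|w v IH].
  by rewrite big_nil ltNge d2.
rewrite big_cons gt_min => /orP [h|/IH [w' w'v h]].
  by exists w; rewrite ?mem_head.
by exists w'; rewrite // inE w'v orbT.
Qed.
Local Open Scope classical_set_scope.
Local Open Scope ring_scope.

Theorem theorem1p3 (R : realType) :
  exists2 c : R, 0 < c &
    exists N : nat, forall n : nat, (N <= n)%N ->
      1 / (2 * n%:R) + c * ln n%:R / (n%:R ^+ 2 * ln (ln n%:R) ^+ 2)
        <= delta_inf R n.
Proof.
(* With this constant [64 n (2 n delta0 - 1) = 2 ^ 7 c L] equals [L / (2 ^ 8 * 10 ^ 3)], small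
   enough for [asymptotic_contradiction]. *)
pose c : R := (2 ^+ 7 * (2 ^+ 8 * 10 ^+ 3))^-1.
have c0 : 0 < c by rewrite invr_gt0 !mulr_gt0 ?exprn_gt0.
exists c => //.
(* Ensures [ln (ln n) >= 10 ^ 7]. *)
exists (Num.truncn (expR (expR (10 ^+ 7)) : R)).+1 => n Nn.
have nE : expR (expR (10 ^+ 7)) <= n%:R :> R.
  have /andP [_ h] := truncn_itv (expR_ge0 (expR (10 ^+ 7 : R))).
  by apply: le_trans (ltW h) _; rewrite ler_nat.
have np : 0 < n%:R :> R by apply: lt_le_trans nE; exact: expR_gt0.
have n0 : (0 < n)%N by rewrite -(ltr0n R).
set lam := ln n%:R; set mu := ln lam.
have lamE : expR (10 ^+ 7) <= lam.
  by rewrite -[leLHS]expRK ler_ln ?posrE ?expR_gt0.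
have muE : 10 ^+ 7 <= mu.
  by rewrite -[leLHS]expRK ler_ln ?posrE ?expR_gt0 // (lt_le_trans _ lamE) ?expR_gt0.
have l0 := lam_gt0 muE.
have mu1 : 1 <= mu by apply: le_trans muE; lra.
have mu0 : 0 < mu by exact: lt_le_trans mu1.
pose L := lam / mu ^+ 2.
have L0 : 0 < L by rewrite divr_gt0 // exprn_gt0.
set delta0 := 1 / (2 * n%:R) + _.
have dE : 2 * n%:R * delta0 - 1 = 2 * (c * L / n%:R).
  by rewrite /delta0 /L; field; rewrite !lt0r_neq0.
have lamn : lam <= n%:R.
  have := @le_ln1Dx R (n%:R - 1); rewrite [1 + _]addrC subrK -/lam.
  by move=> /(_ ltac:(move: np; lra)); lra.
have Ln : L <= n%:R.
  apply: le_trans lamn.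
  by rewrite ler_pdivrMr ?exprn_gt0 // ler_peMr ?(ltW l0) // exprn_ege1.
have cLn : c * L / n%:R <= 1 / 8.
  rewrite ler_pdivrMr //.
  have : c <= 1 / 8.
    rewrite /c -[1 / 8]/(1 * 8^-1) mul1r lef_pV2 ?posrE ?mulr_gt0 ?exprn_gt0 //; lra.
  by move=> c8; rewrite ler_pM // ltW.
have cLn0 : 0 < c * L / n%:R by rewrite divr_gt0 // mulr_gt0.
have d1 : 1 / (2 * n%:R) < delta0.
  by rewrite /delta0 ltrDl divr_gt0 ?mulr_gt0 ?exprn_gt0.
have d2 : 2 * n%:R * delta0 <= 5 / 4 by move: dE cLn; lra.
apply: lb_le_inf.
  (* The speeds [1, ..., n] show that the infimum is over a nonempty set, so that lower bounds pass
     to it. *)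
  pose v : n.-tuple int := [tuple (i.+1)%:Z | i < n].
  exists (delta R v), v => //; split.
    by rewrite map_inj_uniq ?enum_uniq // => i j [] /ord_inj.
  by apply/mapP => -[i _].
move=> _ [v [uv v0] <-]; rewrite leNgt; apply/negP => dv.
have n2 : 2 <= n%:R :> R.
  by move: (lam_ge muE) lamn; rewrite -/lam; lra.
have dhalf : delta0 <= 2^-1.
  rewrite -(ler_pM2l (_ : 0 < 2 * n%:R)) ?mulr_gt0 //; lra.
(* Opposite speeds have the same set [B_w], so absolute values without repetition suffice; there may
   be fewer than [n] of them. *)
have cov (t : R) : exists2 w, w \in undup [seq `|w|%N | w <- v] & dist_int (t * w%:R) <= delta0.
  have [t0 e tmax] := delta_max R v.
  have [|w wv h] := @min_dist_lt R v t delta0 dhalf.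
    by apply: le_lt_trans (tmax t) _; rewrite -e.
  exists `|w|%N; first by rewrite mem_undup map_f.
  apply: ltW; apply: le_lt_trans h.
  have [w0|w0] := leP 0 w.
    by rewrite -[`|w|%N%:R]/((`|w|%N)%:Z%:~R) gez0_abs.
  by rewrite -[`|w|%N%:R]/((`|w|%N)%:Z%:~R) ltz0_abs // intrN mulrN dist_int_opp.
(* The successor makes [T] positive and an upper bound for [2 ^ 7 c L]. *)
pose T := (Num.truncn (2 ^+ 7 * c * L)).+1.
have /andP [T1 T2] := truncn_itv (mulr_ge0 (mulr_ge0 (exprn_ge0 7 (ler0n R 2)) (ltW c0)) (ltW L0)).
have [|||G [uG G0 sG GT]] := @good_speeds R delta0 n T _ n0 (undup_uniq _) _ _ d1 d2 _ cov.
- move=> w; rewrite mem_undup => /mapP [z zv ->].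
  by rewrite absz_gt0; apply: contraNneq v0 => <-.
- by rewrite (leq_trans (size_undup _)) // size_map size_tuple.
- rewrite dE; apply: le_trans (ltW T2).
  by rewrite le_eqVlt; apply/orP; left; apply/eqP; field; rewrite lt0r_neq0.
have TL : T%:R <= lam / mu ^+ 2 / (2 ^+ 8 * 10 ^+ 3) + 1.
  rewrite /T -[(Num.truncn _).+1%:R]natr1 lerD2r; apply: le_trans T1 _; rewrite -/L /c.
  by rewrite le_eqVlt; apply/orP; left; apply/eqP; field.
(* Just above twice the square root of [n]: [y * y] exceeds [2 n], and the terms of order [T y]
   remain negligible. *)
pose y := (Num.truncn (2 * expR (lam / 2))).+1.
have yn := y_sqr_gt muE (erefl y).
have [||D hD hn] := @core_bounds n T G n0 uG G0 GT y _ _ yn.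
- by rewrite lt0n; apply: contraTneq n0 => e; move: sG; rewrite e muln0 leqn0 => /eqP ->.
- have := far_terms_le muE TL.
  rewrite -(ler_nat R) (natrM _ 32) natrD natrM !natrX.
  have : (8 * T).+1%:R <= (8 * T).+1%:R ^+ 4 :> R by rewrite ler_eXnr // ler1n.
  by move: ((8 * T).+1%:R) (_ ^+ 4) => a b; lra.
apply: (asymptotic_contradiction muE (erefl y) _ TL (hD R)) => //.
by rewrite (leq_trans sG) // leq_mul2l.
Qed.
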